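(* Let $\mathcal{M}$ be a finite-dimensional $\mathbb{Z}$-graded manifold, let $\nabla$ be a torsionfree connection on $T_{\mathcal{M}}$, let $\mathrm{pbw}$ be the associated formal exponential map and let $\tau:C^\infty(\mathcal{M})\to\Omega^0(\mathcal{M},\hat{S}(T^\vee_{\mathcal{M}}))$ be the unique map with $\sigma\circ\tau=\mathrm{id}_{C^\infty(\mathcal{M})}$ and $D\circ\tau=0$. Let $(x_i)_{i\in\{1,\dots,n\}}$ be a set of local coordinates on $\mathcal{M}$ and let $(y_j)_{j\in\{1,\dots,n\}}$ be the induced local frame of $T_{\mathcal{M}}^\vee$ regarded as fiberwise linear functions on $T_{\mathcal{M}}$. For all $f\in C^\infty(\mathcal{M})$, we have $$\tau(f)=\sum_{I\in\mathbb{N}_0^n}\frac{1}{I!}\,y^I\otimes\mathrm{pbw}\big(\underleftarrow{\partial_x^I}\big)(f),$$ where, for $I=(i_1,\dots,i_n)\in\mathbb{N}_0^n$, $\underleftarrow{\partial_x^I}=\underbrace{\partial_{x_n}\odot\cdots\odot\partial_{x_n}}_{i_n}\odot\underbrace{\partial_{x_{n-1}}\odot\cdots\odot\partial_{x_{n-1}}}_{i_{n-1}}\odot\cdots\odot\underbrace{\partial_{x_1}\odot\cdots\odot\partial_{x_1}}_{i_1}$.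
   Context: $\Bbbk$ is $\mathbb{R}$ or $\mathbb{C}$; $|\cdot|$ denotes degree; $\mathbb{N}_0$ is the set of nonnegative integers; $I!=i_1!\cdots i_n!$, $|I|=i_1+\cdots+i_n$, $y^I=(y_1)^{i_1}\cdots(y_n)^{i_n}$. The expression $y^I\otimes g$ with $g$ a function on $\mathcal M$ denotes the product $(1\otimes y^I)\cdot(g\otimes1)$, in this order. A $\mathbb{Z}$-graded manifold $\mathcal{M}$ is a smooth manifold $M$ (the support) with a sheaf $\mathcal{O}_{\mathcal{M}}$ of $\mathbb{Z}$-graded, graded-commutative algebras over $M$ such that every point of $M$ has an open neighborhood $U$ with $\mathcal{O}_{\mathcal{M}}(U)\cong C^\infty(U)\otimes\hat{S}(V^\vee)$, for a fixed $\mathbb{Z}$-graded vector space $V$, where $\hat S(V^\vee)$ denotes the formal power series on $V$; it is finite-dimensional if $\dim M$ and $\dim V$ are finite. $C^\infty(\mathcal{M})=\mathcal{O}_{\mathcal{M}}(M)$. $\Gamma(T_{\mathcal{M}})$ is the module of vector fields (graded derivations of functions) with graded commutator bracket. A connection on a vector bundle $\mathcal{E}\to\mathcal{M}$ is a degree $0$ $\Bbbk$-linear map $\nabla:\Gamma(T_{\mathcal{M}})\otimes\Gamma(\mathcal{E})\to\Gamma(\mathcal{E})$ with $\nabla_{fX}S=f\nabla_XS$ and $\nabla_X(fS)=X(f)S+(-1)^{|X||f|}f\nabla_XS$. Its covariant differential $d^\nabla:\Omega^\bullet(\mathcal{M},\mathcal{E})\to\Omega^{\bullet+1}(\mathcal{M},\mathcal{E})$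 is the degree $+1$ map with $i_X(d^\nabla S)=\nabla_XS$ and $d^\nabla(\alpha\wedge\beta)=d\alpha\wedge\beta+(-1)^{|\alpha|}\alpha\wedge d^\nabla\beta$. A connection on $T_{\mathcal{M}}$ is torsionfree if $\nabla_XY-(-1)^{|X||Y|}\nabla_YX-[X,Y]=0$ for all homogeneous $X,Y$. $S(T_{\mathcal{M}})$ is the graded symmetric algebra bundle with product $\odot$; $\hat{S}(T^\vee_{\mathcal{M}})$ is the completed symmetric algebra of the dual bundle. $\nabla$ extends to $S(T_{\mathcal{M}})$ by $\nabla_Xf=X(f)$ and $\nabla_X(X_0\odot\cdots\odot X_n)=\sum_{k}(-1)^{|X|(|X_0|+\cdots+|X_{k-1}|)}X_0\odot\cdots\odot\nabla_XX_k\odot\cdots\odot X_n$, and to the dual bundle $\hat{S}(T^\vee_{\mathcal{M}})$ by $X(\langle S|\sigma\rangle)=\langle\nabla_XS|\sigma\rangle+(-1)^{|X||S|}\langle S|\nabla_X\sigma\rangle$, where for homogeneous $X_i\in\Gamma(T_{\mathcal{M}})$, $\alpha_j\in\Gamma(T^\vee_{\mathcal{M}})$, $\langle X_1\odot\cdots\odot X_p|\alpha_1\odot\cdots\odot\alpha_q\rangle$ is $0$ if $p\neq q$ and $\sum_{\sigma\in S_p}\epsilon\, i_{X_1}\alpha_{\sigma(1)}\cdots i_{X_p}\alpha_{\sigma(p)}$ if $p=q$, $\epsilon$ being the Koszul sign of $X_1,\dots,X_p,\alpha_1,\dots,\alpha_p\mapsto X_1,\alpha_{\sigma(1)},\dots,X_p,\alpha_{\sigma(p)}$.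 $d^\nabla$ below denotes the covariant differential of the connection on $\hat{S}(T^\vee_{\mathcal{M}})$. $\mathcal{U}(T_{\mathcal{M}})=\mathcal{D}(\mathcal{M})$ is the algebra of differential operators on $\mathcal{M}$ with composition product $\cdot$. The formal exponential map is the morphism of left $C^\infty(\mathcal{M})$-modules $\mathrm{pbw}:\Gamma(S(T_{\mathcal{M}}))\to\mathcal{D}(\mathcal{M})$ determined by $\mathrm{pbw}(f)=f$, $\mathrm{pbw}(X)=X$, and, for $n\geqslant1$ and homogeneous $X_0,\dots,X_n\in\Gamma(T_{\mathcal M})$, $\mathrm{pbw}(X_0\odot\cdots\odot X_n)=\frac1{n+1}\sum_{k=0}^n\epsilon_k\{X_k\cdot\mathrm{pbw}(X^{\{k\}})-\mathrm{pbw}(\nabla_{X_k}(X^{\{k\}}))\}$, with $\epsilon_k=(-1)^{|X_k|(|X_0|+\cdots+|X_{k-1}|)}$ and $X^{\{k\}}=X_0\odot\cdots\widehat{X_k}\cdots\odot X_n$. In local coordinates as in the claim ($|y_j|=|x_j|$; $dx_i$ has degree $1+|x_i|$; $i_X$ has degree $|X|-1$), for $\omega\in\Omega^p(\mathcal{M})$ and $f\in\Gamma(S^qT^\vee_{\mathcal{M}})$: $$\delta(\omega\otimes f)=\sum_i(-1)^{|\partial/\partial y_i||\omega|}dx_i\wedge\omega\otimes\tfrac{\partial}{\partial y_i}(f),\qquad\delta^{-1}(\omega\otimes f)=\tfrac1{p+q}\sum_i(-1)^{|y_i||\omega|}i_{\partial/\partial x_i}\omega\otimes y_i\cdot f$$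 ($\delta^{-1}=0$ when $p=q=0$). These are coordinate independent; $\delta^{-1}$ extends to $\Omega^\bullet(\mathcal{M},\hat{S}(T^\vee_{\mathcal{M}})\otimes T_{\mathcal{M}})$ by acting on the $\Omega\otimes\hat S$ part. Elements $\sum A^i_{J,k}\,dx_i\otimes y^J\frac{\partial}{\partial y_k}$ of $\Omega^1(\mathcal{M},\hat{S}(T^\vee_{\mathcal{M}})\otimes T_{\mathcal{M}})$ act on $\Omega^\bullet(\mathcal{M},\hat{S}(T^\vee_{\mathcal{M}}))$ as $1$-forms valued in fiberwise formal vector fields, with Koszul signs. For torsionfree $\nabla$ there is a unique $A^\nabla\in\Omega^1(\mathcal{M},\hat{S}^{\geqslant2}(T^\vee_{\mathcal{M}})\otimes T_{\mathcal{M}})$ of degree $+1$ with $\delta^{-1}(A^\nabla)=0$ such that $D=-\delta+d^\nabla+A^\nabla$ satisfies $D\circ D=0$; this defines $D$. $\sigma:\Omega^\bullet(\mathcal{M},\hat{S}(T^\vee_{\mathcal{M}}))\to C^\infty(\mathcal{M})$ is the degree $0$ linear map with $\sigma(f\otimes1)=f$ for $f\in C^\infty(\mathcal{M})$, $\sigma(\omega\otimes y^J)=0$ for $\omega\in\Omega^{\geqslant1}(\mathcal{M})$, and $\sigma(f\otimes y^J)=0$ for $|J|\geqslant1$. For every $f\in C^\infty(\mathcal{M})$ there is a unique $\xi\in\Gamma(\hat{S}(T^\vee_{\mathcal{M}}))$ with $\sigma(\xi)=f$ and $D(\xi)=0$; $\tau(f):=\xi$. (These existence and uniqueness facts may be assumed.)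 *)

(* Defs.v *)
From HB Require Import structures.
From mathcomp Require Import all_boot all_order all_algebra.
From mathcomp Require Import fingroup perm.
From mathcomp Require Import complex.
From mathcomp Require Import all_classical all_reals all_analysis.

Set Implicit Arguments.
Unset Strict Implicit.
Unset Printing Implicit Defensive.

Import Order.TTheory GRing.Theory Num.Theory.
Import numFieldNormedType.Exports.

Local Open Scope classical_set_scope.
Local Open Scope ring_scope.

(* The ground field is R or C; C-valued functions live on real manifolds and
   are smooth when their real and imaginary parts are. *)

Variant ground := Reals | Complexes.

Definition scal (R : realType) (k : ground) : fieldType :=
  match k with Reals => R | Complexes => R[i] end.

Definition repart (R : realType) (k : ground) : scal R k -> R :=
  match k return scal R k -> R with
  | Reals => fun z => z
  | Complexes => fun z => complex.Re (z : R[i])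
  end.

Definition impart (R : realType) (k : ground) : scal R k -> R :=
  match k return scal R k -> R with
  | Reals => fun=> 0
  | Complexes => fun z => complex.Im (z : R[i])
  end.

Definition emb (R : realType) (k : ground) : R -> scal R k :=
  match k return R -> scal R k with
  | Reals => fun x => x
  | Complexes => fun x => (x%:C)%C
  end.

Section Smooth.
Variables (R : realType) (m : nat).

Fixpoint Ck (n : nat) (A : set 'rV[R]_m) (f : 'rV[R]_m -> R) : Prop :=
  match n with
  | 0 => forall u, A u -> {for u, continuous f}
  | n'.+1 => forall i : 'I_m,
      (forall u, A u -> derivable f u (delta_mx 0 i)) /\
      Ck n' A (fun u => 'D_(delta_mx 0 i) f u)
  end.

Definition smooth (A : set 'rV[R]_m) (f : 'rV[R]_m -> R) : Prop :=
  forall n, Ck n A f.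

Record schart (T : topologicalType) := SChart {
  sdom : set T;
  smap : T -> 'rV[R]_m;
  sinv : 'rV[R]_m -> T }.

Definition schart_ok (T : topologicalType) (c : schart T) : Prop :=
  [/\ open (sdom c), open (smap c @` sdom c),
      forall p, sdom c p -> sinv c (smap c p) = p,
      forall p, sdom c p -> {for p, continuous (smap c)} &
      forall u, (smap c @` sdom c) u -> {for u, continuous (sinv c)}].

Definition smooth_transition (T : topologicalType) (c c' : schart T) : Prop :=
  forall i : 'I_m,
    smooth (smap c @` (sdom c `&` sdom c')) (fun u => smap c' (sinv c u) 0 i).

Record smanifold := SManifold {
  points :> topologicalType;
  _ : hausdorff_space points;
  _ : @second_countable points;
  atlas : set (schart points);
  _ : forall c, atlas c -> schart_ok c;
  _ : forall p : points, exists2 c, atlas c & sdom c p;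
  _ : forall c c', atlas c -> atlas c' -> smooth_transition c c' }.

Definition is_schart (M : smanifold) (c : schart M) : Prop :=
  schart_ok c /\
  forall c', atlas c' -> smooth_transition c c' /\ smooth_transition c' c.

Definition smooth_fun (M : smanifold) (k : ground) (W : set M)
    (f : M -> scal R k) : Prop :=
  forall c, @atlas M c ->
    smooth (smap c @` (sdom c `&` W)) (fun u => repart (f (sinv c u))) /\
    smooth (smap c @` (sdom c `&` W)) (fun u => impart (f (sinv c u))).

End Smooth.

(* A series in variables v_0, ..., v_(N-1) of degrees [deg] over a graded
   algebra A is the family of its coefficients, written to the right of the
   monomials: [f] stands for \sum_J v^J f_J, v^J = v_0^(J_0) v_1^(J_1) ...
   The square of a variable of odd degree is 0, so that only the coefficients
   at the [adm]issible J are meaningful; all operations return 0 elsewhere. *)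

Definition mi (N : nat) := {ffun 'I_N -> nat}.

(* J_0 times 0, then J_1 times 1, ... *)
Definition word (N : nat) (J : mi N) : seq 'I_N :=
  flatten [seq nseq (J b) b | b <- enum 'I_N].

Definition eps {A : pzRingType} (z : int) : A := (-1) ^+ `|z|%N.

Section Series.
Variables (A : pzRingType) (N : nat) (deg : 'I_N -> int).
Implicit Types (f g : mi N -> A) (J : mi N) (a : 'I_N).

Definition mi0 : mi N := [ffun=> 0%N].
Definition unitmi a : mi N := [ffun b => (b == a : nat)].
Definition addmi J J' : mi N := [ffun b => (J b + J' b)%N].
Definition submi J J' : mi N := [ffun b => (J b - J' b)%N].
Definition msize J : nat := (\sum_(b < N) J b)%N.
Definition mfact J : nat := (\prod_(b < N) (J b)`!)%N.
Definition wt J : int := \sum_(b < N) deg b *+ J b.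
Definition adm J : bool := [forall b, odd `|deg b|%N ==> (J b <= 1)%N].

(* v^J v^J' = eps (msign J J') v^(J + J') *)
Definition msign J J' : int :=
  \sum_(a < N) \sum_(b < N | (b < a)%N) (deg a * deg b) *+ (J a * J' b).

Definition psone : mi N -> A := fun J => (J == mi0)%:R.

(* product f g of a series f of total degree e with a series g *)
Definition psmul (e : int) f g : mi N -> A := fun J =>
  if adm J then
    \sum_(J' : {ffun 'I_N -> 'I_(msize J).+1} | [forall b, (J' b <= J b)%N])
      let J1 : mi N := [ffun b => J' b : nat] in
      let J2 := submi J J1 in
      eps ((e - wt J1) * wt J2 + msign J1 J2) * f J1 * g J2
  else 0.

(* left multiplication by v_a *)
Definition psvar a f : mi N -> A := fun J =>
  if adm J && (0 < J a)%N then
    eps (deg a * \sum_(b < N | (b < a)%N) deg b *+ J b) * f (submi J (unitmi a))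
  else 0.

(* left derivative with respect to v_a, a derivation of degree - deg a *)
Definition psder a f : mi N -> A := fun J =>
  if adm J then
    eps (deg a * \sum_(b < N | (b < a)%N) deg b *+ J b)
      * (f (addmi J (unitmi a)) *+ (J a).+1)
  else 0.

(* v_0^(J_0) v_1^(J_1) ... with series [w b] of degree [d b] for v_b *)
Definition psmono (N' : nat) (d : 'I_N' -> int) (w : 'I_N' -> mi N -> A)
    (J : mi N') : mi N -> A :=
  foldr (fun b acc => psmul (d b) (w b) acc) psone (word J).

End Series.
Arguments mi0 {N}.
Arguments psone {A N}.

(* Sheaves of Z-graded, graded commutative K-algebras. [sec] and [res] are
   total; the axioms concern open sets only. K acts through [cst], and
   [hom U d] is the degree d part of sec U = \bigoplus_d hom U d. Gluing is
   degree by degree, as in the category of graded algebras. *)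
Record gsheaf (K : fieldType) (T : topologicalType) := GSheaf {
  sec : set T -> pzRingType;
  cst : forall U, {rmorphism K -> sec U};
  hom : forall U, int -> set (sec U);
  res : forall U V, sec U -> sec V;
  _ : forall U d, open U -> @hom U d 0;
  _ : forall U d f g, open U -> @hom U d f -> @hom U d g -> @hom U d (f - g);
  _ : forall U a, open U -> @hom U 0 (cst U a);
  _ : forall U d e f g, open U ->
        @hom U d f -> @hom U e g -> @hom U (d + e) (f * g);
  _ : forall U d e f g, open U ->
        @hom U d f -> @hom U e g -> f * g = eps (d * e) * (g * f);
  _ : forall U f, open U -> exists (s : seq int) (F : int -> sec U),
        (forall d, @hom U d (F d)) /\ f = \sum_(d <- s) F d;
  _ : forall U (s : seq int) (F : int -> sec U), open U -> uniq s ->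
        (forall d, @hom U d (F d)) -> \sum_(d <- s) F d = 0 ->
        forall d, d \in s -> F d = 0;
  _ : forall U f, open U -> @res U U f = f;
  _ : forall U V W f, open U -> open V -> open W ->
        W `<=` V -> V `<=` U -> @res V W (@res U V f) = @res U W f;
  _ : forall U V f g, open U -> open V -> V `<=` U ->
        @res U V (f + g) = @res U V f + @res U V g;
  _ : forall U V f g, open U -> open V -> V `<=` U ->
        @res U V (f * g) = @res U V f * @res U V g;
  _ : forall U V a, open U -> open V -> V `<=` U ->
        @res U V (cst U a) = cst V a;
  _ : forall U V d f, open U -> open V -> V `<=` U ->
        @hom U d f -> @hom V d (@res U V f);
  _ : forall (C : set (set T)) f, (forall V, C V -> open V) ->
        (forall V, C V -> @res (\bigcup_(W in C) W) V f = 0) -> f = 0;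
  _ : forall (C : set (set T)) d (s : forall V, sec V),
        (forall V, C V -> open V) -> (forall V, C V -> @hom V d (s V)) ->
        (forall V W, C V -> C W ->
           @res V (V `&` W) (s V) = @res W (V `&` W) (s W)) ->
        exists2 f, @hom (\bigcup_(W in C) W) d f &
          forall V, C V -> @res (\bigcup_(W in C) W) V f = s V }.

Section Trivializations.
Variables (R : realType) (k : ground) (m r : nat) (M : smanifold R m).
Variables (F : gsheaf (scal R k) M) (fdeg : 'I_r -> int).

(* An isomorphism from F|U to C^\infty_U \otimes \hat S(V^\vee), where V^\vee has
   a basis of degrees [fdeg]: [coef W f J] is the coefficient of v^J, a smooth
   function on W; its values off W are irrelevant. *)
Definition trivialization (U : set M)
    (coef : forall W, sec F W -> mi r -> M -> scal R k) : Prop :=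
  forall W, open W -> W `<=` U ->
  (forall f J, smooth_fun W (coef W f J)) /\
  (forall f J p, W p -> ~~ adm fdeg J -> coef W f J p = 0) /\
  (forall d f J p, W p -> hom d f -> coef W f J p != 0 -> wt fdeg J = d) /\
  (forall f g J p, W p -> coef W (f + g) J p = coef W f J p + coef W g J p) /\
  (forall a J p, W p -> coef W (cst F W a) J p = a * psone J) /\
  (forall d f g J p, W p -> hom d f ->
     coef W (f * g) J p =
     psmul fdeg d (coef W f ^~ p) (coef W g ^~ p) J) /\
  (forall f, (forall J p, W p -> coef W f J p = 0) -> f = 0) /\
  (forall d (g : mi r -> M -> scal R k),
     (forall J, smooth_fun W (g J)) ->
     (forall J p, W p -> g J p != 0 -> adm fdeg J /\ wt fdeg J = d) ->
     exists2 f, hom d f & forall J p, W p -> coef W f J p = g J p) /\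
  (forall V f J p, open V -> V `<=` W -> V p ->
     coef V (res V f) J p = coef W f J p).

End Trivializations.

Record gmanifold (R : realType) (k : ground) (m r : nat) := GManifold {
  body :> smanifold R m;
  fns : gsheaf (scal R k) body;
  fdeg : 'I_r -> int;
  _ : forall p : body, exists U coef,
        [/\ open U, U p & @trivialization R k m r body fns fdeg U coef] }.

Section GradedGeometry.
Variables (R : realType) (k : ground) (m r : nat) (M : gmanifold R k m r).

Definition O (U : set M) : pzRingType := sec (fns M) U.
Definition isH (U : set M) (d : int) : set (O U) := hom d.
Definition restr (U V : set M) (f : O U) : O V := res V f.
Definition kst (U : set M) (a : scal R k) : O U := cst (fns M) U a.

Definition vfield (U : set M) (d : int) (X : O U -> O U) : Prop :=
  [/\ forall f g, X (f + g) = X f + X g,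
      forall a f, X (kst U a * f) = kst U a * X f,
      forall e f, isH e f -> isH (d + e) (X f) &
      forall e f g, isH e f -> X (f * g) = X f * g + eps (d * e) * f * X g].

Definition vrestricts (U V : set M) (X : O U -> O U) (X' : O V -> O V) :=
  forall f, X' (restr V f) = restr V (X f).

(* A connection on T_M is given as a morphism of sheaves: its values on each open
   set, compatible with restriction. *)
Record connection := Connection {
  nabla : forall U : set M, (O U -> O U) -> (O U -> O U) -> O U -> O U;
  _ : forall U d e X Y, open U -> @vfield U d X -> @vfield U e Y ->
        vfield (d + e) (nabla X Y);
  _ : forall U d e X X' Y, open U -> @vfield U d X -> @vfield U d X' ->
        @vfield U e Y ->
        nabla (fun f => X f + X' f) Y = fun f => nabla X Y f + nabla X' Y f;
  _ : forall U d e X Y Y', open U -> @vfield U d X -> @vfield U e Y ->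
        @vfield U e Y' ->
        nabla X (fun f => Y f + Y' f) = fun f => nabla X Y f + nabla X Y' f;
  _ : forall U b d e (h : O U) X Y, open U -> isH b h -> @vfield U d X ->
        @vfield U e Y ->
        nabla (fun f => h * X f) Y = fun f => h * nabla X Y f;
  _ : forall U b d e (h : O U) X Y, open U -> isH b h -> @vfield U d X ->
        @vfield U e Y ->
        nabla X (fun f => h * Y f) =
        fun f => X h * Y f + eps (d * b) * h * nabla X Y f;
  _ : forall U V d e X Y X' Y', open U -> open V -> V `<=` U ->
        @vfield U d X -> @vfield U e Y -> @vfield V d X' -> @vfield V e Y' ->
        vrestricts X X' -> vrestricts Y Y' ->
        vrestricts (nabla X Y) (nabla X' Y') }.

Definition torsionfree (D : connection) : Prop :=
  forall U d e X Y, open U -> @vfield U d X -> @vfield U e Y ->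
  forall f, nabla D X Y f - eps (d * e) * nabla D Y X f
            - (X (Y f) - eps (d * e) * Y (X f)) = 0.

(* A list [:: (d_0, X_0); ...; (d_n, X_n)] of homogeneous vector fields with their
   degrees stands for the monomial X_0 \odot ... \odot X_n of S(T_M); such
   monomials span S(T_M), and pbw and \nabla are given by their values on them. *)
Definition vf (U : set M) := (int * (O U -> O U))%type.

Section Monomials.
Variables (D : connection) (U : set M).
Implicit Types (X : vf U) (s : seq (vf U)).

Definition sdeg s : int := \sum_(X <- s) X.1.

(* \nabla_X (X_0 \odot ... \odot X_n) is the sum of eps t.1 times the monomial
   t.2, for t in [nablaS X s] *)
Definition nablaS X s : seq (int * seq (vf U)) :=
  [seq let Y := nth X s j in
       (X.1 * sdeg (take j s),
        set_nth X s j (X.1 + Y.1, nabla D X.2 Y.2)) | j <- iota 0 (size s)].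

Fixpoint pbw_rec (n : nat) s (f : O U) : O U :=
  match n, s with
  | n'.+1, X0 :: _ :: _ =>
      kst U ((size s)%:R^-1) *
      \sum_(j < size s)
        let X := nth X0 s j in
        let s' := take j s ++ drop j.+1 s in
        eps (X.1 * sdeg (take j s)) *
        (X.2 (pbw_rec n' s' f)
         - \sum_(t <- nablaS X s') eps t.1 * pbw_rec n' t.2 f)
  | _, [:: X] => X.2 f
  | _, _ => f
  end.

Definition pbw s : O U -> O U := pbw_rec (size s) s.

End Monomials.

(* [cperm] orders the m smooth and r formal coordinates. [cd] is the frame of
   coordinate vector fields, [cd c i] being \partial/\partial x_i: it is the
   dual of the dx_i and a frame of T_M on the domain. *)

Local Notation n := (m + r)%N.

Record coords := Coords {
  cchart : schart R m M;
  ctriv : forall W, O W -> mi r -> M -> scal R k;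
  cperm : 'S_n;
  cx : 'I_n -> O (sdom cchart);
  cd : 'I_n -> O (sdom cchart) -> O (sdom cchart);
  cdeg : 'I_n -> int :=
    fun i => match fintype.split (cperm i) with inl _ => 0 | inr a => fdeg M a end;
  _ : is_schart cchart;
  _ : @trivialization R k m r M (fns M) (fdeg M) (sdom cchart) ctriv;
  _ : forall i, isH (cdeg i) (cx i);
  _ : forall i J p, sdom cchart p ->
        ctriv (cx i) J p =
        match fintype.split (cperm i) with
        | inl b => emb k (smap cchart p 0 b) * psone J
        | inr a => (J == unitmi a)%:R
        end;
  _ : forall i, vfield (- cdeg i) (cd i);
  _ : forall i j, cd i (cx j) = (i == j)%:R;
  _ : forall d X, vfield d X -> forall f, X f = \sum_(i < n) X (cx i) * cd i f }.

Definition cdom (c : coords) : set M := sdom (cchart c).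

(* On the domain of c, forms with values in \hat S(T^\vee) are series in dx_0, ..., dx_(n-1), y_0, ..., y_(n-1),
   of degrees 1 + |x_i| and |x_i|, in this order, with coefficients in O. *)

Definition vdeg (c : coords) (a : 'I_(n + n)) : int :=
  match fintype.split a with inl i => 1 + cdeg c i | inr i => cdeg c i end.

Definition dxv (i : 'I_n) : 'I_(n + n) := lshift n i.
Definition yv (i : 'I_n) : 'I_(n + n) := rshift n i.

Definition dxpart (J : mi (n + n)) : mi n := [ffun i => J (dxv i)].
Definition ypart (J : mi (n + n)) : mi n := [ffun i => J (yv i)].
Definition joinmi (K I : mi n) : mi (n + n) :=
  [ffun a => match fintype.split a with inl i => K i | inr i => I i end].

Definition lform (c : coords) := mi (n + n) -> O (cdom c).

(* p-forms of total degree q *)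
Definition homform (c : coords) (p : nat) (q : int) (w : lform c) : Prop :=
  forall J, isH (q - wt (vdeg c) J) (w J) /\
            (w J != 0 -> adm (vdeg c) J /\ msize (dxpart J) = p).

Definition is_pform (c : coords) (p : nat) (w : lform c) : Prop :=
  exists (s : seq int) (W : int -> lform c),
    (forall q, homform p q (W q)) /\ w = fun J => \sum_(q <- s) W q J.

(* Change of coordinates from c to c', for dom c' \subseteq dom c:
   dx_j = \sum_i dx'_i \partial'_i x_j and y_j = \sum_i y'_i \partial'_i x_j. *)

Definition jac (c c' : coords) (i j : 'I_n) : O (cdom c') :=
  cd (c := c') i (restr (cdom c') (cx c j)).

Definition newvar (c c' : coords) (a : 'I_(n + n)) : lform c' := fun J =>
  match fintype.split a with
  | inl j => \sum_(i < n) (J == unitmi (dxv i))%:R * jac c c' i j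
  | inr j => \sum_(i < n) (J == unitmi (yv i))%:R * jac c c' i j
  end.

(* The substitution preserves the number of variables, whence the finite sum. *)
Definition transfer (c c' : coords) (w : lform c) : lform c' := fun J =>
  \sum_(J' : {ffun 'I_(n + n) -> 'I_(msize J).+1})
    let J1 : mi (n + n) := [ffun b => J' b : nat] in
    psmono (vdeg c') (vdeg c) (newvar c c') J1 J * restr (cdom c') (w J1).

(* a form on M is a family of local forms that agree on overlaps *)
Definition glues (w : forall c, lform c) : Prop :=
  forall c c', cdom c' `<=` cdom c -> w c' = transfer c' (w c).

Definition is_form (p : nat) (w : forall c, lform c) : Prop :=
  glues w /\ forall c, is_pform p (w c).

Section Operators.
Variables (D : connection) (c : coords).
Local Notation U := (cdom c).
Local Notation x := (cx c).
Local Notation deg := (cdeg c).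
Local Notation vd := (vdeg c).

(* The sign (-1)^(|\partial/\partial y_i||w|) in \delta (w \otimes f) is the one
   by which \partial/\partial y_i, acting from the left, passes w; similarly
   for y_i in \delta^-1. *)
Definition delta (w : lform c) : lform c := fun J =>
  \sum_(i < n) psvar vd (dxv i) (psder vd (yv i) w) J.

Definition deltainv (w : lform c) : lform c := fun J =>
  kst U ((msize J)%:R^-1) *
  \sum_(i < n) psder vd (dxv i) (psvar vd (yv i) w) J.

Definition frame (i : 'I_n) : vf U := (- deg i, cd (c := c) i).

(* \partial_(x_n)^(i_n) \odot ... \odot \partial_(x_1)^(i_1) *)
Definition dback (I : mi n) : seq (vf U) :=
  flatten [seq nseq (I i) (frame i) | i <- rev (enum 'I_n)].

(* <X_1 \odot ... \odot X_p | y^I>, for p = |I| *)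
Definition pairmono (s : seq (vf U)) (I : mi n) : O U :=
  let X j := nth (0, id) s j in
  let al j := nth (0, 0) [seq (deg i, x i) | i <- word I] j in
  \sum_(u : 'S_(size s))
    eps (\sum_(a < size s) \sum_(b < size s | (b < a)%N)
           ((X a).1 * (al (u b)).1
            + (if (u a < u b)%N then (al (u b)).1 * (al (u a)).1 else 0)))
    * \prod_(a < size s) (X a).2 (al (u a)).2.

(* <X_1 \odot ... \odot X_p | \sum_I y^I xi_I> *)
Definition pairing (s : seq (vf U)) (xi : mi n -> O U) : O U :=
  \sum_(I' : {ffun 'I_n -> 'I_(size s).+1})
    let I : mi n := [ffun b => I' b : nat] in
    if msize I == size s then pairmono s I * xi I else 0.

(* \nabla_(\partial_i) on \hat S(T^\vee): the coefficient of y^I is obtained from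
   the duality with \nabla on S(T) at S = \partial_x^I (in reverse order),
   since <S | y^I'> is I! for I' = I and 0 otherwise. *)
Definition dualnabla (i : 'I_n) (xi : mi n -> O U) : mi n -> O U := fun I =>
  if adm deg I then
    kst U ((mfact I)%:R^-1) * eps (deg i * sdeg (dback I)) *
    (cd i (pairing (dback I) xi)
     - \sum_(t <- nablaS D (frame i) (dback I)) eps t.1 * pairing t.2 xi)
  else 0.

(* \nabla_(\partial_i) (dx^K \otimes xi) := (-1)^(|x_i||dx^K|) dx^K \otimes
   \nabla_(\partial_i) xi, so that d^\nabla is \sum_i dx_i \nabla_(\partial_i) *)
Definition formnabla (i : 'I_n) (w : lform c) : lform c := fun J =>
  eps (deg i * wt vd (joinmi (dxpart J) mi0)) *
  dualnabla i (fun I => w (joinmi (dxpart J) I)) (ypart J).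

Definition covd (w : lform c) : lform c := fun J =>
  \sum_(i < n) psvar vd (dxv i) (formnabla i w) J.

(* action of A = \sum_k A_k \partial/\partial y_k, of degree 1 *)
Definition act (A : 'I_n -> lform c) (w : lform c) : lform c := fun J =>
  \sum_(j < n) psmul vd (1 + deg j) (A j) (psder vd (yv j) w) J.

Definition Dop (A : 'I_n -> lform c) (w : lform c) : lform c := fun J =>
  - delta w J + covd w J + act A w J.

(* \sum_I y^I \otimes g_I *)
Definition yseries (g : mi n -> O U) : lform c := fun J =>
  if adm vd J && (dxpart J == mi0) then g (ypart J) else 0.

End Operators.

(* A^\nabla = \sum_k A_k \partial/\partial y_k in
   \Omega^1 (M, \hat S^(>= 2)(T^\vee) \otimes T). In the first condition
   \partial/\partial y is contracted with y_j = \sum_i y'_i \partial'_i x_j. *)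
Definition is_Anabla (D : connection)
    (A : forall c : coords, 'I_n -> lform c) : Prop :=
  (forall c c', cdom c' `<=` cdom c -> forall j J,
     transfer c' (A c j) J = \sum_(i < n) A c' i J * jac c c' i j) /\
  (forall c j, homform 1 (1 + cdeg c j) (A c j)) /\
  (forall c j J, A c j J != 0 -> (2 <= msize (ypart J))%N) /\
  (forall c j J, deltainv (A c j) J = 0) /\
  (forall c p q (w : lform c), homform p q w ->
     forall J, Dop D (A c) (Dop D (A c) w) J = 0).

Definition sigma (w : forall c, lform c) (c : coords) : O (cdom c) :=
  w c mi0.

Definition is_tau (D : connection) (A : forall c : coords, 'I_n -> lform c)
    (tau : O setT -> forall c, lform c) : Prop :=
  forall f, [/\ is_form 0 (tau f),
    forall c, sigma (tau f) c = restr (cdom c) f &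
    forall c J, Dop D (A c) (tau f c) J = 0].

End GradedGeometry.

(* Main.v *)
Require Import Defs.
From mathcomp Require Import all_boot all_order all_algebra.
From mathcomp Require Import all_classical all_reals all_analysis.
From mathcomp Require Import fingroup perm zify complex.

Set Implicit Arguments.
Unset Strict Implicit.
Unset Printing Implicit Defensive.

Import GRing.Theory Num.Theory.
Local Open Scope classical_set_scope.
Local Open Scope ring_scope.

(** In a coordinate domain let xi be the series with tau(f) = sum_I y^I xi_I, and
    let Phi(S) = <S | xi> be its pairing with monomials S in vector fields.  The
    coefficients are recovered from Phi by Phi(d_x^I) = I! xi_I
    ([pairing_dback]), so the claim is Phi(S) = pbw(S)(f).

    Contract the flatness equation -delta xi + d^nabla xi + A xi = 0 with
    sum_i y_i i_(d/dx_i), which is delta^-1 without its weight factor.  On delta xi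
    this gives the number operator, |I| xi_I; on d^nabla xi it gives
    sum_i y_i nabla_i xi; on A xi it gives 0, because A acts by derivatives in the y
    only, so that the contraction falls on A, and delta^-1 A = 0
    ([contraction_act]).  Hence |I| xi_I = (sum_i y_i nabla_i xi)_I
    ([Dop_recursion]).

    Since nabla on series is dual to nabla on S(T), this says that Phi satisfies
      (n+1) Phi(X_0 ... X_n) =
        sum_k eps_k (X_k Phi(X^{k}) - Phi(nabla_(X_k) X^{k}))
    for monomials in the frame d_1, ..., d_n: this is the recursion that defines
    pbw.  The recursion has to be known for arbitrary vector fields, as
    nabla_(X_k) leaves the monomials in the frame.  Both sides are graded
    symmetric and function-linear in the X_k: the left one by Laplace expansion of
    the graded permanent that defines the pairing ([permanent_cons],
    [pairing_cons]), the right one because the Leibniz terms X_k(h) Phi(...) of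
    its two parts cancel ([pbw_step_tensorial]).  Such functionals are determined
    by their values on ordered monomials in the frame ([tensorial_eq0]), whence the
    recursion holds in general ([pbw_step_pairing]), and induction on n gives
    Phi(S) = pbw(S)(f) ([pbw_pairing]). *)

(** * Koszul signs *)

Lemma odd_absD (a b : int) : odd (absz (a + b)) = odd `|a|%N (+) odd `|b|%N.
Proof. lia. Qed.

Lemma odd_absN (a : int) : odd (absz (- a)) = odd `|a|%N.
Proof. by rewrite abszN. Qed.

Lemma odd_absM (a b : int) : odd (absz (a * b)) = odd `|a|%N && odd `|b|%N.
Proof. by rewrite abszM oddM. Qed.

Lemma odd_absMn (a : int) n : odd (absz (a *+ n)) = odd `|a|%N && odd n.
Proof. by rewrite -mulr_natr odd_absM natz absz_nat. Qed.

(** A sign depends on its exponent modulo 2 only: an equality between signs is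
    checked by a truth table in the parities of the degrees, sums being atoms. *)
Ltac parity :=
  rewrite ?(odd_absD, odd_absN, odd_absM, odd_absMn) /=;
  repeat match goal with |- context [odd ?x] => case: (odd x) => //= end.

Section Signs.
Variable S : pzRingType.
Implicit Types (a b : int) (f g : S).

Lemma epsE a : eps a = (-1) ^+ odd `|a|%N :> S.
Proof. by rewrite /eps signr_odd. Qed.

Lemma eps_parity a b : odd `|a|%N = odd `|b|%N -> eps a = eps b :> S.
Proof. by rewrite !epsE => ->. Qed.

Lemma eps0 : eps 0 = 1 :> S.
Proof. by []. Qed.

Lemma eps_even a : ~~ odd `|a|%N -> eps a = 1 :> S.
Proof. by rewrite epsE => /negbTE->. Qed.

Lemma epsD a b : eps (a + b) = eps a * eps b :> S.
Proof. by rewrite !epsE odd_absD signr_addb. Qed.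

Lemma eps_eps a b f : eps a * (eps b * f) = eps (a + b) * f.
Proof. by rewrite epsD mulrA. Qed.

Lemma eps_comm a f : f * eps a = eps a * f.
Proof. by rewrite /eps; exact: commr_sign. Qed.

Lemma mul_eps a f g : f * (eps a * g) = eps a * (f * g).
Proof. by rewrite mulrA eps_comm mulrA. Qed.

Lemma nat_comm n f : f * n%:R = n%:R * f.
Proof. by rewrite mulr_natr mulr_natl. Qed.

Lemma mul_nat n f g : f * (n%:R * g) = n%:R * (f * g).
Proof. by rewrite mulrA nat_comm mulrA. Qed.

End Signs.

(** * Koszul-signed sums over the entries of a list *)

Section PickSum.
Variables (T : Type) (d : T -> int) (P : pred T) (S : pzRingType).
Implicit Types (F G : T -> seq T -> S) (s : seq T).

(** Sum over the ways to extract one entry y of s, leaving r, of F y r with the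
    Koszul sign of moving y to the front.  The recursion on s, with F varying,
    replaces bookkeeping with positions; [picksumE] gives the positional form. *)
Fixpoint picksum F s : S :=
  if s is x :: s' then
    F x s' + picksum (fun y r => eps (d x * d y) * F y (x :: r)) s'
  else 0.

Lemma picksum_cons F x s : picksum F (x :: s) =
  F x s + picksum (fun y r => eps (d x * d y) * F y (x :: r)) s.
Proof. by []. Qed.

Lemma picksumE F s x0 :
  \sum_(j < size s) eps (d (nth x0 s j) * \sum_(x <- take j s) d x)
     * F (nth x0 s j) (take j s ++ drop j.+1 s) = picksum F s.
Proof.
elim: s F => [|x s IH] F /=; first by rewrite big_ord0.
rewrite big_ord_recl /= big_nil mulr0 eps0 mul1r drop0; congr (_ + _).
rewrite -IH; apply: eq_bigr => j _ /=.
rewrite big_cons eps_eps; congr (_ * _); apply: eps_parity.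
by parity.
Qed.

Lemma eq_picksum F G s :
  (forall y r, P y -> all P r -> (size r).+1 = size s -> F y r = G y r) ->
  all P s -> picksum F s = picksum G s.
Proof.
elim: s F G => //= x s IH F G FG /andP[Px Ps].
rewrite FG //; congr (_ + _); apply: IH => // y r Py Pr sr.
by rewrite FG //= ?Px // sr.
Qed.

Lemma picksum_sum (I : finType) (h : I -> S) (F : I -> T -> seq T -> S) s :
  picksum (fun y r => \sum_i h i * F i y r) s = \sum_i h i * picksum (F i) s.
Proof.
elim: s F => [|x s IH] F /=; first by rewrite big1 // => i; rewrite mulr0.
under [RHS]eq_bigr do rewrite mulrDr.
rewrite big_split -IH /=; congr (_ + picksum _ s).
apply/funext => y; apply/funext => r; rewrite mulr_sumr.
by apply: eq_bigr => i _; rewrite mul_eps.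
Qed.

Lemma picksumZ a F s :
  picksum (fun y r => a * F y r) s = a * picksum F s.
Proof.
have := picksum_sum (fun _ : 'I_1 => a) (fun=> F) s.
rewrite big_ord1 => <-; congr (picksum _ s).
by apply/funext => y; apply/funext => r; rewrite big_ord1.
Qed.

Definition gsymmetric (F : seq T -> S) := forall s1 x y s2,
  all P (s1 ++ x :: y :: s2) ->
  F (s1 ++ x :: y :: s2) = eps (d x * d y) * F (s1 ++ y :: x :: s2).

Lemma gsymmetric_cons (F : seq T -> S) x : P x -> gsymmetric F ->
  gsymmetric (fun s => F (x :: s)).
Proof. by move=> Px symF s1 y z s2 Ps; rewrite (symF (x :: s1)) //= Px. Qed.

Lemma gsymmetric_scale a (F : seq T -> S) : gsymmetric F ->
  gsymmetric (fun s => a * F s).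
Proof. by move=> symF s1 x y s2 Ps; rewrite symF // mul_eps. Qed.

(** In F x (y :: s) and F y (x :: s) one of the two exchanged entries has been
    extracted: the exchange swaps these two terms.  In all other terms x and y
    remain neighbours in the argument of the symmetric functional. *)
Lemma gsymmetric_picksum F : (forall y, P y -> gsymmetric (F y)) ->
  gsymmetric (picksum F).
Proof.
move=> symF s1 x y s2; elim: s1 F symF => [|a s1 IH] F symF /=.
  case/and3P => Px Py Ps.
  rewrite !mulrDr eps_eps (@eps_even _ (_ + _)) ?mul1r; last by parity.
  rewrite addrCA; congr (_ + (_ + _)); rewrite -picksumZ.
  apply: eq_picksum Ps => z q Pz Pq _.
  rewrite -[x :: y :: q]cat0s symF //= ?Px ?Py // !eps_eps.
  by congr (_ * _); apply: eps_parity; parity.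
case/andP=> Pa Ps; rewrite symF // IH // -?mulrDr // => z Pz.
by apply: gsymmetric_scale; apply: gsymmetric_cons => //; exact: symF.
Qed.

Lemma gsymmetric_front (F : seq T -> S) s1 x s2 : gsymmetric F ->
  all P (s1 ++ x :: s2) ->
  F (s1 ++ x :: s2) = eps (d x * \sum_(y <- s1) d y) * F (x :: s1 ++ s2).
Proof.
move=> symF; elim/last_ind: s1 s2 => [|s1 y IH] s2.
  by rewrite big_nil mulr0 eps0 mul1r.
rewrite cat_rcons => Ps.
have Ps' : all P (s1 ++ x :: y :: s2).
  by move: Ps; rewrite !all_cat /=; case: (P x); case: (P y).
rewrite symF // IH // eps_eps cat_rcons -cats1 big_cat big_seq1 /=.
by congr (_ * _); apply: eps_parity; parity.
Qed.

End PickSum.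

Lemma picksum_map (T T' : Type) (d : T -> int) (d' : T' -> int) (h : T -> T')
    (S : pzRingType) (F : T' -> seq T' -> S) s :
  (forall x y, d' (h x) * d' (h y) = d x * d y) ->
  picksum d' F (map h s) = picksum d (fun y r => F (h y) (map h r)) s.
Proof.
move=> dh; elim: s F => //= x s IH F; rewrite IH; congr (_ + picksum _ _ _).
by apply/funext => y; apply/funext => r; rewrite dh.
Qed.

Lemma sum_count (T : finType) (V : nmodType) (P : pred T) (d : T -> V) s :
  \sum_(b <- s | P b) d b = \sum_(b | P b) d b *+ count_mem b s.
Proof.
elim: s => [|a s IH]; first by rewrite big_nil big1.
rewrite big_cons IH; under [RHS]eq_bigr do rewrite /= mulrnDr.
rewrite big_split /=; case: ifP => Pa.
  congr (_ + _); rewrite (bigD1 a) //= eqxx big1 ?addr0 // => b /andP[_ /negbTE].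
  by rewrite eq_sym => ->.
rewrite [X in _ = X + _]big1 ?add0r // => b Pb.
by case: eqP Pb Pa => [->->|].
Qed.

Section SortedPicks.
Variables (T : finType) (d : T -> int) (leT : rel T) (S : pzRingType).
Hypotheses (leT_anti : antisymmetric leT) (leT_tr : transitive leT).

(** All copies of a letter i contribute equally: if i occurs several times, its
    degree is even and moving it past another copy costs no sign.  Passing the
    letters that precede i gives the remaining sign. *)
Lemma picksum_sorted (F : T -> seq T -> S) s :
  sorted leT s -> (forall a, odd `|d a|%N -> (count_mem a s <= 1)%N) ->
  picksum d F s =
  \sum_i (eps (d i * \sum_(b | (b != i) && leT b i) d b *+ count_mem b s)
            * F i (rem i s)) *+ count_mem i s.
Proof.
have -> : \sum_i (eps (d i * \sum_(b | (b != i) && leT b i) d b *+ count_mem b s)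
            * F i (rem i s)) *+ count_mem i s =
  \sum_i (eps (d i * \sum_(b <- s | (b != i) && leT b i) d b)
            * F i (rem i s)) *+ count_mem i s.
  by apply: eq_bigr => i _; rewrite [in RHS]sum_count.
elim: s F => [|a s IH] F /=; first by rewrite big1.
rewrite path_sortedE // => /andP[/allP sa ss] odd1.
rewrite IH //; last first.
  by move=> b /odd1; apply: leq_trans; exact: leq_addl.
under [RHS]eq_bigr do rewrite mulrnDr.
rewrite big_split /=; congr (_ + _).
  rewrite (bigD1 a) //= !eqxx [X in _ = _ + X]big1 ?addr0; last first.
    by move=> i /negbTE; rewrite eq_sym => ->.
  rewrite big_cons eqxx big_seq_cond big1 ?mulr0 ?eps0 ?mul1r // => b.
  by case/and3P=> /sa ab ba1 ba2; case/eqP: ba1; apply: leT_anti; rewrite ab ba2.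
apply: eq_bigr => i _; case: (posnP (count_mem i s)) => [->//|].
rewrite -has_count has_pred1 => is_; congr (_ *+ _).
case: eqP => [ai|/eqP ai].
  subst i; have ev : ~~ odd `|d a|%N.
    apply/negP => /odd1; rewrite eqxx /= add1n ltnS leqn0.
    by rewrite -leqn0 leqNgt -has_count has_pred1 is_.
  rewrite big_cons eqxx /= !(@eps_even _ (d a * _)) ?odd_absM ?(negbTE ev) //.
  rewrite !mul1r; congr (F a _).
  case: {IH odd1} s sa ss is_ => //= b s sa.
  rewrite path_sortedE // => /andP[/allP sb _].
  rewrite inE => /orP[/eqP->|as_]; first by rewrite eqxx.
  have -> : a = b by apply: leT_anti; rewrite sa ?inE ?eqxx // sb.
  by rewrite eqxx.
rewrite big_cons ai sa // eps_eps.
by congr (_ * _); apply: eps_parity; parity.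
Qed.

End SortedPicks.

(** * Multi-indices and sorted words *)

Section Words.
Variable N : nat.
Implicit Types (I J : mi N) (e : seq 'I_N).

(** [word] and [dback] both write out a multi-index, in increasing and in
    decreasing order of the letters; e is that order. *)
Definition spell e I : seq 'I_N := flatten [seq nseq (I b) b | b <- e].

Lemma count_spell e I b : count_mem b (spell e I) = (count_mem b e * I b)%N.
Proof.
elim: e => //= a e IH; rewrite /spell /= count_cat -/(spell e I) IH mulnDl.
by rewrite count_nseq /=; case: eqP => [->|].
Qed.

Lemma sorted_spell (leT : rel 'I_N) e I :
  reflexive leT -> transitive leT -> sorted leT e -> sorted leT (spell e I).
Proof.
move=> refl tr; rewrite !sorted_pairwise //.
elim: e => //= a e IH /andP[/allP ae /IH se].
rewrite /spell /= pairwise_cat -/(spell e I) se andbT; apply/andP; split.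
  apply/allrelP => x y; rewrite mem_nseq => /andP[_ /eqP->].
  by case/flatten_mapP => b /ae ab; rewrite mem_nseq => /andP[_ /eqP->].
apply/(pairwiseP a) => i j; rewrite !inE size_nseq => il jl _.
by rewrite !nth_nseq il jl.
Qed.

Lemma addmiB I a : (0 < I a)%N -> addmi (submi I (unitmi a)) (unitmi a) = I.
Proof.
move=> Ia; apply/ffunP => b; rewrite !ffunE.
by case: eqP => [->|_] /=; rewrite ?subnK // subn0 addn0.
Qed.

Lemma submiD I a : submi (addmi I (unitmi a)) (unitmi a) = I.
Proof. by apply/ffunP => b; rewrite !ffunE addnK. Qed.

Lemma msize_addmi I J : msize (addmi I J) = (msize I + msize J)%N.
Proof.
by rewrite /msize -big_split; apply: eq_bigr => b _; rewrite ffunE.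
Qed.

Lemma msize_unitmi a : msize (unitmi a : mi N) = 1%N.
Proof.
by rewrite /msize (bigD1 a) //= ffunE eqxx big1 // => b /negbTE;
   rewrite ffunE => ->.
Qed.

Lemma msize_submi I a : (0 < I a)%N ->
  msize I = (msize (submi I (unitmi a))).+1.
Proof. by move=> Ia; rewrite -{1}(addmiB Ia) msize_addmi msize_unitmi addn1. Qed.

Lemma mfact_submi I a : (0 < I a)%N ->
  mfact I = (mfact (submi I (unitmi a)) * I a)%N.
Proof.
move=> Ia; rewrite /mfact (bigD1 a) //= [in RHS](bigD1 a) //= !ffunE eqxx subn1.
rewrite mulnAC [(_`! * I a)%N]mulnC -{2}(prednK Ia) -factS prednK //.
by congr (_ * _)%N; apply: eq_bigr => b /negbTE ba; rewrite !ffunE ba subn0.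
Qed.

Lemma mfact_gt0 I : (0 < mfact I)%N.
Proof. by rewrite prodn_gt0 // => b; exact: fact_gt0. Qed.

Section Complete.
Variable e : seq 'I_N.
Hypothesis e_all : forall b, count_mem b e = 1%N.

Lemma count_spell1 I b : count_mem b (spell e I) = I b.
Proof. by rewrite count_spell e_all mul1n. Qed.

Lemma sum_spell (V : nmodType) (P : pred 'I_N) (d : 'I_N -> V) I :
  \sum_(b <- spell e I | P b) d b = \sum_(b | P b) d b *+ I b.
Proof. by rewrite sum_count; apply: eq_bigr => b _; rewrite count_spell1. Qed.

Lemma size_spell I : size (spell e I) = msize I.
Proof.
have -> : size (spell e I) = \sum_(b <- spell e I) 1%N.
  by elim: (spell e I) => [|a l IH]; rewrite ?big_nil // big_cons -IH.
rewrite sum_spell; apply: eq_bigr => b _; exact: natn.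
Qed.

Lemma spell_sorted_uniq (leT : rel 'I_N) l I : reflexive leT -> transitive leT ->
  antisymmetric leT -> sorted leT e -> sorted leT l ->
  (forall b, count_mem b l = I b) -> l = spell e I.
Proof.
move=> refl tr anti se sl cl; apply: (sorted_eq tr anti) => //.
  exact: sorted_spell.
by apply/allP => b _ /=; rewrite cl count_spell1.
Qed.

Lemma rem_spell (leT : rel 'I_N) I a : reflexive leT -> transitive leT ->
  antisymmetric leT -> sorted leT e -> (0 < I a)%N ->
  rem a (spell e I) = spell e (submi I (unitmi a)).
Proof.
move=> refl tr anti se Ia.
apply: (@spell_sorted_uniq leT) => //.
  by apply: (subseq_sorted tr (rem_subseq _ _)); exact: sorted_spell.
move=> b; rewrite count_rem count_spell1 !ffunE.
by rewrite -has_pred1 has_count count_spell1 Ia /= eq_sym.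
Qed.

End Complete.

Definition ascending : seq 'I_N := enum 'I_N.
Definition descending : seq 'I_N := rev (enum 'I_N).

Lemma count_ascending b : count_mem b ascending = 1%N.
Proof. by rewrite count_uniq_mem ?enum_uniq // mem_enum. Qed.

Lemma count_descending b : count_mem b descending = 1%N.
Proof. by rewrite count_rev count_ascending. Qed.

Definition le_ord : rel 'I_N := fun a b => (a <= b)%N.
Definition ge_ord : rel 'I_N := fun a b => (b <= a)%N.

Lemma sorted_ascending : sorted le_ord ascending.
Proof.
have := iota_sorted 0 N; rewrite -val_enum_ord sorted_map; exact.
Qed.

Lemma sorted_descending : sorted ge_ord descending.
Proof. by rewrite rev_sorted; exact: sorted_ascending. Qed.

Lemma le_ord_refl : reflexive le_ord. Proof. by move=> a; exact: leqnn. Qed.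
Lemma le_ord_trans : transitive le_ord.
Proof. by move=> b a c; exact: leq_trans. Qed.
Lemma le_ord_anti : antisymmetric le_ord.
Proof. by move=> a b /anti_leq; exact: val_inj. Qed.
Lemma ge_ord_refl : reflexive ge_ord. Proof. by move=> a; exact: leqnn. Qed.
Lemma ge_ord_trans : transitive ge_ord.
Proof. by move=> b a c ba cb; exact: leq_trans cb ba. Qed.
Lemma ge_ord_anti : antisymmetric ge_ord.
Proof. by move=> a b; rewrite andbC => /anti_leq; exact: val_inj. Qed.

Lemma wordE I : word I = spell ascending I. Proof. by []. Qed.

Variables (deg : 'I_N -> int) (S : pzRingType).

Lemma adm_le1 I a : adm deg I -> odd `|deg a|%N -> (I a <= 1)%N.
Proof. by move/forallP/(_ a)/implyP. Qed.

Lemma adm_sub I J : adm deg I -> (forall b, (J b <= I b)%N) -> adm deg J.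
Proof.
move=> aI JI; apply/forallP => b; apply/implyP => odb.
exact: leq_trans (JI b) (adm_le1 aI odb).
Qed.

Lemma adm_submi I J : adm deg I -> adm deg (submi I J).
Proof. by move/adm_sub; apply => b; rewrite ffunE leq_subr. Qed.

Lemma adm_addmi I J : adm deg (addmi I J) -> adm deg I.
Proof. by move/adm_sub; apply => b; rewrite ffunE leq_addr. Qed.

Lemma picksum_word I (F : 'I_N -> seq 'I_N -> S) : adm deg I ->
  picksum deg F (word I) =
  \sum_(i < N) (eps (deg i * \sum_(b < N | (b < i)%N) deg b *+ I b)
      * F i (word (submi I (unitmi i)))) *+ I i.
Proof.
move=> aI; rewrite (picksum_sorted le_ord_anti le_ord_trans).
- apply: eq_bigr => i _; rewrite wordE count_spell1; last exact: count_ascending.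
  case: (posnP (I i)) => [->//|Ii]; congr (_ *+ _).
  rewrite (rem_spell count_ascending le_ord_refl le_ord_trans le_ord_anti
             sorted_ascending) //.
  congr (eps (_ * _) * _); apply: eq_big => [b|b _].
    by rewrite ltn_neqAle.
  by rewrite count_spell1 //; exact: count_ascending.
- exact: sorted_spell le_ord_refl le_ord_trans sorted_ascending.
- by move=> a oa; rewrite wordE (count_spell1 count_ascending); exact: adm_le1 oa.
Qed.

Lemma picksum_descending I (F : 'I_N -> seq 'I_N -> S) : adm deg I ->
  picksum deg F (spell descending I) =
  \sum_(i < N) (eps (deg i * \sum_(b < N | (i < b)%N) deg b *+ I b)
      * F i (spell descending (submi I (unitmi i)))) *+ I i.
Proof.
move=> aI; rewrite (picksum_sorted ge_ord_anti ge_ord_trans).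
- apply: eq_bigr => i _; rewrite count_spell1; last exact: count_descending.
  case: (posnP (I i)) => [->//|Ii]; congr (_ *+ _).
  rewrite (rem_spell count_descending ge_ord_refl ge_ord_trans ge_ord_anti
             sorted_descending) //.
  congr (eps (_ * _) * _); apply: eq_big => [b|b _].
    by rewrite ltn_neqAle eq_sym.
  by rewrite count_spell1 //; exact: count_descending.
- exact: sorted_spell ge_ord_refl ge_ord_trans sorted_descending.
- by move=> a oa; rewrite (count_spell1 count_descending); exact: adm_le1 oa.
Qed.

End Words.

(** * Laplace expansion of graded permanents *)

Lemma nth_delete (T : Type) (x0 : T) (l : seq T) j k : (j < size l)%N ->
  nth x0 (take j l ++ drop j.+1 l) k = nth x0 l (bump j k).
Proof.
move=> jl; rewrite nth_cat size_takel ?(ltnW jl) // /bump.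
have [kj|jk] /= := ltnP k j; first by rewrite nth_take.
by rewrite nth_drop; congr nth; lia.
Qed.

(** Injectivity suffices, since both index sets have (p + 1)! elements. *)
Lemma sum_lift_perm p (V : nmodType) (F : 'S_p.+1 -> V) :
  \sum_u F u = \sum_(j < p.+1) \sum_(v : 'S_p) F (lift_perm ord0 j v).
Proof.
pose h (jv : 'I_p.+1 * 'S_p) := lift_perm ord0 jv.1 jv.2.
have h_inj : injective h.
  move=> [j v] [j' v'] /permP; rewrite /h /= => e.
  have ej := e ord0; rewrite !lift_perm_id in ej; subst j'; congr pair.
  apply/permP => q; apply: (@lift_inj _ j).
  by have := e (lift ord0 q); rewrite !lift_perm_lift.
rewrite (reindex h) /=; first by rewrite pair_bigA.
apply: onW_bij; apply: inj_card_bij => //.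
by rewrite card_prod !card_Sn card_ord factS.
Qed.

Section Laplace.
Variables (T : Type) (S : pzRingType) (deg : T -> int) (x : T -> S).
Variable V : Type.
Variables (vdg : V -> int) (act : V -> S -> S) (v0 : V).

(** The pairing of two monomials, for abstract vector fields and letters: the
    permanent of the matrix act X_j (x_i) with Koszul signs. *)
Definition permanent (s : seq V) (l : seq T) : S :=
  let X j := nth v0 s j in
  let al j := nth (0, 0) [seq (deg i, x i) | i <- l] j in
  \sum_(u : 'S_(size s))
    eps (\sum_(a < size s) \sum_(b < size s | (b < a)%N)
           (vdg (X a) * (al (u b)).1
            + (if (u a < u b)%N then (al (u b)).1 * (al (u a)).1 else 0)))
    * \prod_(a < size s) act (X a) (al (u a)).2.

Lemma permanent_nil : permanent [::] [::] = 1.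
Proof.
rewrite /permanent /= (big_pred1 1%g) => [|u]; last first.
  by apply/esym/eqP/permP => -[].
by rewrite !big_ord0 mulr1.
Qed.

(** Laplace expansion along the first row: a permutation is given by the image j of
    0 and a permutation of what remains, and the sign of moving the j-th letter to
    the front splits off. *)
Lemma permanent_cons X s l : size l = (size s).+1 ->
  permanent (X :: s) l =
  picksum deg (fun i r => eps (deg i * \sum_(Y <- s) vdg Y) * act X (x i)
                          * permanent s r) l.
Proof.
move=> sl; have [i0 _] : {i0 : T & True} by case: l sl => // i0; exists i0.
rewrite -(picksumE _ _ _ i0) {1}/permanent -[size (X :: s)]/((size s).+1).
set H := (X in _ = \sum_(j < _) X j); pose H' (j : nat) := 
  eps (deg (nth i0 l j) * \sum_(y <- take j l) deg y) *
  (eps (deg (nth i0 l j) * \sum_(Y <- s) vdg Y) * act X (x (nth i0 l j)) *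
   permanent s (take j l ++ drop j.+1 l)).
transitivity (\sum_(0 <= j < (size s).+1) H' j); last by rewrite -sl big_mkord.
rewrite big_mkord sum_lift_perm /=; apply: eq_bigr => j _.
have jl : (j < size l)%N by rewrite sl.
have alE q : (q < size l)%N ->
    nth (0, 0) [seq (deg i, x i) | i <- l] q = (deg (nth i0 l q), x (nth i0 l q)).
  by move=> ql; rewrite (nth_map i0).
rewrite /H' /permanent !mulr_sumr; apply: eq_bigr => v _.
set l' := take j l ++ drop j.+1 l.
have sl' : size l' = size s.
  by rewrite size_cat size_takel ?(ltnW jl) // size_drop sl; have := ltn_ord j; lia.
have vl (a : 'I_(size s)) : (v a < size l')%N by rewrite sl'.
have al'E (q : 'I_(size s)) :
    nth (0, 0) [seq (deg i, x i) | i <- l'] q =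
    nth (0, 0) [seq (deg i, x i) | i <- l] (lift j q).
  rewrite /= (nth_map i0) ?sl' // nth_delete // alE // sl.
  by have := ltn_ord (lift j q).
have lift_lt (a b : 'I_(size s)) : (lift j a < lift j b)%N = (a < b)%N.
  by rewrite /= /bump; lia.
rewrite -[in RHS](mulrA (eps _) (act _ _)) [act _ _ * (eps _ * _)]mul_eps !eps_eps.
congr (_ * _); last first.
  rewrite big_ord_recl /= lift_perm_id alE //; congr (_ * _).
  by apply: eq_bigr => a _; rewrite lift_perm_lift al'E.
(* The pairs (a, b) with b = 0 give the sign of moving the j-th letter past the
   fields and past the letters before it; the others give the smaller permanent. *)
congr eps; rewrite big_ord_recl [X in X + _]big1 // add0r.
under eq_bigr => a _ do rewrite big_mkcond big_ord_recl /=.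
rewrite big_split /=; congr (_ + _); last first.
  apply: eq_bigr => a _; rewrite [RHS]big_mkcond; apply: eq_bigr => b _ /=.
  rewrite !lift_perm_lift !al'E lift_lt /bump !leq0n !add1n ltnS.
  by case: ifP.
under eq_bigr => a _ do
  rewrite lift_perm_id lift_perm_lift alE // -al'E.
rewrite big_split /= addrC; congr (_ + _); last first.
  rewrite [in RHS](big_nth v0) big_mkord.
  by apply: eq_bigr => a _; rewrite mulrC.
(* The inversions that involve the j-th letter are the letters before it,
   whatever v is. *)
rewrite (reindex_inj (@perm_inj _ v^-1%g)) /=.
rewrite (big_nth i0) size_takel ?(ltnW jl) // big_mkord.
rewrite (big_ord_widen (size s) (fun q => _ * deg (nth i0 (take j l) q)));
  last by have := ltn_ord j; rewrite ltnS.
rewrite [RHS]big_mkcond /=; apply: eq_bigr => q _.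
rewrite permKV al'E /= alE; last first.
  by rewrite sl; exact: ltn_ord (lift j q).
have [qj|jq] := ltnP q j; first by rewrite /bump (leqNgt j q) qj add0n qj nth_take.
by rewrite ifN // -leqNgt /bump jq add1n ltnW.
Qed.

End Laplace.

(** * Sums over multi-indices *)

Section MultiIndexSums.
Variable N : nat.

(** The exponents of degree p as a duplicate-free list, so that sums over different
    degrees can be compared by shifts of the exponent. *)
Definition multis (p : nat) : seq (mi N) :=
  [seq I <- [seq [ffun b => I' b : nat] | I' : {ffun 'I_N -> 'I_p.+1}]
     | msize I == p].

Lemma leq_msize (I : mi N) b : (I b <= msize I)%N.
Proof. by rewrite /msize (bigD1 b) //= leq_addr. Qed.

Lemma mem_multis p (I : mi N) : (I \in multis p) = (msize I == p).
Proof.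
rewrite mem_filter; case: eqP => //= sI; apply/mapP.
exists [ffun b => inord (I b)]; first exact: mem_enum.
by apply/ffunP => b; rewrite !ffunE inordK // ltnS -sI leq_msize.
Qed.

Lemma multis_uniq p : uniq (multis p).
Proof.
rewrite filter_uniq // map_inj_uniq ?enum_uniq // => I J /ffunP IJ.
by apply/ffunP => b; apply: val_inj; have := IJ b; rewrite !ffunE.
Qed.

Lemma sum_multisE (V : nmodType) p (F : mi N -> V) :
  \sum_(I <- multis p) F I =
  \sum_(I' : {ffun 'I_N -> 'I_p.+1})
    if msize [ffun b => I' b : nat] == p then F [ffun b => I' b : nat] else 0.
Proof. by rewrite big_filter big_map big_enum_cond /= -big_mkcondr. Qed.

Lemma sum_multisS (V : nmodType) p a (F : mi N -> V) :
  \sum_(I <- multis p.+1 | (0 < I a)%N) F I =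
  \sum_(I <- multis p) F (addmi I (unitmi a)).
Proof.
rewrite -big_filter -[RHS](big_map (fun I => addmi I (unitmi a)) xpredT).
apply: perm_big; apply: uniq_perm.
- by rewrite filter_uniq // multis_uniq.
- rewrite map_inj_uniq ?multis_uniq // => I J IJ.
  by rewrite -(submiD I a) IJ submiD.
move=> I; rewrite mem_filter mem_multis; apply/andP/mapP => [[Ia]|[J]].
  rewrite (msize_submi Ia) eqSS => sI; exists (submi I (unitmi a)).
    by rewrite mem_multis.
  by rewrite addmiB.
rewrite mem_multis => /eqP <- ->; rewrite msize_addmi msize_unitmi addn1 eqxx.
by rewrite !ffunE eqxx addn1.
Qed.

End MultiIndexSums.

(** * Homogeneous functions, vector fields and connections *)

Section SheafTheory.
Variables (K : fieldType) (T : topologicalType) (F : gsheaf K T) (U : set T).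
Hypothesis oU : open U.

Lemma hom0 d : Defs.hom d (0 : sec F U).
Proof. by case: F => /= ? ? ? ? H *; exact: H. Qed.

Lemma homB d f g : Defs.hom d f -> Defs.hom d g -> Defs.hom d (f - g : sec F U).
Proof. by case: F f g => /= ? ? ? ? _ H *; exact: H. Qed.

Lemma homN d f : Defs.hom d f -> Defs.hom d (- f : sec F U).
Proof. by move=> hf; rewrite -sub0r; apply: homB => //; exact: hom0. Qed.

Lemma homD d f g : Defs.hom d f -> Defs.hom d g -> Defs.hom d (f + g : sec F U).
Proof. by move=> hf hg; rewrite -[g]opprK; apply: homB => //; exact: homN. Qed.

Lemma hom_cst a : Defs.hom 0 (Defs.cst F U a).
Proof. by case: F => /= ? ? ? ? _ _ H *; exact: H. Qed.

Lemma homM d e f g : Defs.hom d f -> Defs.hom e g ->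
  Defs.hom (d + e) (f * g : sec F U).
Proof. by case: F f g => /= ? ? ? ? _ _ _ H *; exact: H. Qed.

Lemma hom_comm d e f g : Defs.hom d f -> Defs.hom e g ->
  f * g = eps (d * e) * (g * f) :> sec F U.
Proof. by case: F f g => /= ? ? ? ? _ _ _ _ H *; exact: H. Qed.

End SheafTheory.

Section VectorFields.
Variables (R : realType) (k : ground) (m r : nat) (M : gmanifold R k m r).
Variable U : set M.
Hypothesis oU : open U.
Local Notation A := (O U).
Implicit Types (X Y : A -> A) (d e : int) (f g h : A).

Lemma vfield_zero d : vfield d (fun=> 0 : A).
Proof.
split=> *; rewrite ?addr0 ?mulr0 ?mul0r ?addr0 //; exact: hom0.
Qed.

Lemma vfield_add d X Y : vfield d X -> vfield d Y ->
  vfield d (fun f => X f + Y f).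
Proof.
move=> [XD XZ Xh XM] [YD YZ Yh YM]; split=> [f g|a f|e f ef|e f g ef].
- by rewrite XD YD addrACA.
- by rewrite XZ YZ mulrDr.
- by apply: homD => //; [exact: Xh|exact: Yh].
- by rewrite (XM e) // (YM e) // addrACA mulrDl mulrDr.
Qed.

Lemma vfield_scale b d h X : isH b h -> vfield d X ->
  vfield (b + d) (fun f => h * X f).
Proof.
move=> hh [XD XZ Xh XM]; split=> [f g|a f|e f ef|e f g ef].
- by rewrite XD mulrDr.
- rewrite XZ !mulrA; congr (_ * _).
  by rewrite (hom_comm oU hh (hom_cst _ oU a)) mulr0 eps0 mul1r.
- by rewrite -addrA; apply: homM => //; exact: Xh.
- rewrite (XM e) // mulrDr mulrA; congr (_ + _).
  rewrite -!mulrA mul_eps [h * (f * _)]mulrA (hom_comm oU hh ef) -!mulrA eps_eps.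
  by congr (_ * _); apply: eps_parity; parity.
Qed.

Lemma fsum_nil (I : Type) (X : I -> A -> A) :
  (fun f => \sum_(i <- [::]) X i f) = fun=> 0.
Proof. by apply/funext => f; rewrite big_nil. Qed.

Lemma fsum_cons (I : Type) i (s : seq I) (X : I -> A -> A) :
  (fun f => \sum_(i <- i :: s) X i f) =
  fun f => X i f + \sum_(i <- s) X i f.
Proof. by apply/funext => f; rewrite big_cons. Qed.

Lemma vfield_sum d (I : Type) (s : seq I) (X : I -> A -> A) :
  (forall i, vfield d (X i)) -> vfield d (fun f => \sum_(i <- s) X i f).
Proof.
move=> vX; elim: s => [|i s IH].
  by rewrite fsum_nil; exact: vfield_zero.
by rewrite fsum_cons; exact: vfield_add.
Qed.

Section OneField.
Variables (d : int) (X : A -> A).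
Hypothesis vX : vfield d X.

Lemma vfD f g : X (f + g) = X f + X g. Proof. by case: vX => + _ _ _; exact. Qed.

Lemma vf_isH e f : isH e f -> isH (d + e) (X f).
Proof. by case: vX => _ _ + _; exact. Qed.

Lemma vfM e f g : isH e f -> X (f * g) = X f * g + eps (d * e) * (f * X g).
Proof. by case: vX => _ _ _ H ef; rewrite (H e) // mulrA. Qed.

Lemma vf0 : X 0 = 0.
Proof. by apply: (addrI (X 0)); rewrite -vfD !addr0. Qed.

Lemma vfN f : X (- f) = - X f.
Proof. by apply/eqP; rewrite -addr_eq0 -vfD addNr vf0. Qed.

Lemma vf_sum (I : Type) (s : seq I) (G : I -> A) :
  X (\sum_(i <- s) G i) = \sum_(i <- s) X (G i).
Proof. exact: (big_morph X vfD vf0). Qed.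

Lemma vf_eps z f : X (eps z * f) = eps z * X f.
Proof. by rewrite !epsE; case: (odd _); rewrite ?mul1r ?mulN1r ?vfN. Qed.

End OneField.

Section Connections.
Variable D : connection M.

Lemma nabla_vfield d e X Y : vfield d X -> vfield e Y ->
  vfield (d + e) (nabla D X Y).
Proof. by move=> vX vY; case: D => /= ? H *; exact: (H _ _ _ _ _ oU vX vY). Qed.

Lemma nabla_addl d e X X' Y : vfield d X -> vfield d X' -> vfield e Y ->
  nabla D (fun f => X f + X' f) Y = fun f => nabla D X Y f + nabla D X' Y f.
Proof.
by move=> vX vX' vY; case: D => /= ? _ H *; exact: (H _ _ _ _ _ _ oU vX vX' vY).
Qed.

Lemma nabla_addr d e X Y Y' : vfield d X -> vfield e Y -> vfield e Y' ->
  nabla D X (fun f => Y f + Y' f) = fun f => nabla D X Y f + nabla D X Y' f.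
Proof.
by move=> vX vY vY'; case: D => /= ? _ _ H *; exact: (H _ _ _ _ _ _ oU vX vY vY').
Qed.

Lemma nabla_scalel b d e h X Y : isH b h -> vfield d X -> vfield e Y ->
  nabla D (fun f => h * X f) Y = fun f => h * nabla D X Y f.
Proof.
by move=> hh vX vY; case: D => /= ? _ _ _ H *; exact: (H _ _ _ _ _ _ _ oU hh vX vY).
Qed.

Lemma nabla_scaler b d e h X Y : isH b h -> vfield d X -> vfield e Y ->
  nabla D X (fun f => h * Y f) =
  fun f => X h * Y f + eps (d * b) * h * nabla D X Y f.
Proof.
by move=> hh vX vY; case: D => /= ? _ _ _ _ H *; exact: (H _ _ _ _ _ _ _ oU hh vX vY).
Qed.

Lemma nabla_suml d e (I : Type) (s : seq I) (X : I -> A -> A) Y :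
  (forall i, vfield d (X i)) -> vfield e Y ->
  nabla D (fun f => \sum_(i <- s) X i f) Y =
  fun f => \sum_(i <- s) nabla D (X i) Y f.
Proof.
move=> vX vY; elim: s => [|i s IH].
  have := nabla_scalel (hom0 _ oU 0) (vfield_zero d) vY.
  rewrite (_ : (fun f => 0 * 0) = fun=> 0); last by apply/funext => f; rewrite mul0r.
  by rewrite !fsum_nil => ->; apply/funext => f; rewrite mul0r.
rewrite !fsum_cons.
by rewrite (nabla_addl (vX i) (vfield_sum s vX) vY) IH.
Qed.

Lemma nabla_sumr d e (I : Type) (s : seq I) X (Y : I -> A -> A) :
  vfield d X -> (forall i, vfield e (Y i)) ->
  nabla D X (fun f => \sum_(i <- s) Y i f) =
  fun f => \sum_(i <- s) nabla D X (Y i) f.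
Proof.
move=> vX vY; elim: s => [|i s IH].
  have := nabla_scaler (hom0 _ oU 0) vX (vfield_zero e).
  rewrite (_ : (fun f => 0 * 0) = fun=> 0); last by apply/funext => f; rewrite mul0r.
  rewrite !fsum_nil => ->; apply/funext => f.
  by rewrite (vf0 vX) mul0r mulr0 mul0r addr0.
rewrite !fsum_cons.
by rewrite (nabla_addr vX (vY i) (vfield_sum s vY)) IH.
Qed.

End Connections.
End VectorFields.

Section Chart.
Variables (R : realType) (k : ground) (m r : nat) (M : gmanifold R k m r).
Variable c : coords M.
Local Notation n := (m + r)%N.
Local Notation U := (cdom c).
Local Notation deg := (cdeg c).
Local Notation x := (cx c).

Lemma open_cdom : open U.
Proof. by rewrite /cdom; case: c => ch ? ? ? ? ? [[H]] *. Qed.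
Let oU := open_cdom.

Lemma isH_cx i : isH (deg i) (x i).
Proof. by rewrite /cdom; case: c i => ? ? ? ? ? ? ? ? H *; exact (H _). Qed.

Lemma vfield_cd i : vfield (- deg i) (cd (c := c) i).
Proof. by rewrite /cdom; case: c i => ? ? ? ? ? ? ? ? ? ? H *; exact (H _). Qed.

Lemma cd_cx i j : cd (c := c) i (x j) = (i == j)%:R.
Proof. by rewrite /cdom; case: c i j => ? ? ? ? ? ? ? ? ? ? ? H *; exact (H _ _). Qed.

Lemma vfield_coords d (X : O U -> O U) : vfield d X ->
  X = fun f => \sum_i X (x i) * cd (c := c) i f.
Proof.
move=> vX; apply/funext => f; move: X d vX f; rewrite /cdom.
case: c => ? ? ? ? ? ? ? ? ? ? ? ? H X d vX f; exact (H _ _ vX _).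
Qed.

Variable D : connection M.

Lemma nabla_coordsl d e X Y f : @vfield _ _ _ _ _ U d X -> vfield e Y ->
  nabla D X Y f = \sum_i X (x i) * nabla D (cd (c := c) i) Y f.
Proof.
move=> vX vY; rewrite {1}(vfield_coords vX).
have hX i : isH (d + deg i) (X (x i)) by apply: vf_isH; last exact: isH_cx.
have vhX i : vfield d (fun f => X (x i) * cd (c := c) i f).
  rewrite -[d](addrK (deg i)); apply: (vfield_scale oU (hX i)).
  exact: vfield_cd.
rewrite (nabla_suml oU D _ vhX vY).
by apply: eq_bigr => i _; rewrite (nabla_scalel oU D (hX i) (vfield_cd i) vY).
Qed.

Lemma nabla_coordsr d e X Y f : @vfield _ _ _ _ _ U d X -> vfield e Y ->
  nabla D X Y f = \sum_i (X (Y (x i)) * cd (c := c) i f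
     + eps (d * (e + deg i)) * (Y (x i) * nabla D X (cd (c := c) i) f)).
Proof.
move=> vX vY; rewrite {1}(vfield_coords vY).
have hY i : isH (e + deg i) (Y (x i)) by apply: vf_isH; last exact: isH_cx.
have vhY i : vfield e (fun f => Y (x i) * cd (c := c) i f).
  rewrite -[e](addrK (deg i)); apply: (vfield_scale oU (hY i)).
  exact: vfield_cd.
rewrite (nabla_sumr oU D _ vX vhY).
apply: eq_bigr => i _.
by rewrite (nabla_scaler oU D (hY i) vX (vfield_cd i)) mulrA.
Qed.

End Chart.

(** * Graded symmetric, function-linear functionals of vector fields *)

Lemma gsymmetric_perm (T : eqType) (d : T -> int) (S : pzRingType)
    (G : seq T -> S) l l' :
  gsymmetric d predT G -> perm_eq l l' -> exists z, G l = eps z * G l'.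
Proof.
elim: l G l' => [|a l IH] G l' symG.
  by rewrite perm_sym => /perm_nilP->; exists 0; rewrite eps0 mul1r.
move=> ll'; have al' : a \in l' by rewrite -(perm_mem ll') mem_head.
case/splitPr: al' ll' => l1 l2 all'.
have ll' : perm_eq l (l1 ++ l2).
  rewrite -(perm_cons a); apply: perm_trans all' _.
  by rewrite perm_catC /= perm_cons perm_catC.
have [z ->] := IH _ _ (gsymmetric_cons (x := a) isT symG) ll'.
rewrite (gsymmetric_front symG) ?all_predT //.
set w : int := d a * _; exists (z + w); rewrite eps_eps; congr (_ * _).
by apply: eps_parity; parity.
Qed.

Section Scalars.
Variables (R : realType) (k : ground) (m r : nat) (M : gmanifold R k m r).
Variable U : set M.

Lemma scal_nat_neq0 j : (0 < j)%N -> j%:R != 0 :> scal R k.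
Proof.
rewrite lt0n => j0; case: k => /=.
  by have := pnatr_eq0 R j; rewrite (negbTE j0) => /negbT.
by have := pnatr_eq0 (complex R) j; rewrite (negbTE j0) => /negbT.
Qed.

Lemma kst_natK j (f : O U) : (0 < j)%N -> kst U (j%:R^-1) * (j%:R * f) = f.
Proof.
move=> j0; rewrite mulrA /kst -(rmorph_nat (Defs.cst (fns M) U)) -rmorphM.
by rewrite mulVf ?scal_nat_neq0 // rmorph1 mul1r.
Qed.

Lemma nat_mul_inj j (f g : O U) : (0 < j)%N -> j%:R * f = j%:R * g -> f = g.
Proof. by move=> j0 e; rewrite -(kst_natK f j0) e kst_natK. Qed.

End Scalars.

Section Functionals.
Variables (R : realType) (k : ground) (m r : nat) (M : gmanifold R k m r).
Variable c : coords M.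
Local Notation n := (m + r)%N.
Local Notation U := (cdom c).
Local Notation deg := (cdeg c).
Local Notation x := (cx c).
Let oU := open_cdom c.

Definition good (X : vf U) : bool := `[< vfield X.1 X.2 >].

Lemma goodP X : reflect (vfield X.1 X.2) (good X).
Proof. exact: asboolP. Qed.

Lemma good_frame i : good (frame c i).
Proof. by apply/goodP; exact: vfield_cd. Qed.

Lemma good_frames l : all good (map (frame c) l).
Proof. by elim: l => //= i l ->; rewrite good_frame. Qed.

Lemma dbackE I : dback c I = map (frame c) (spell (descending n) I).
Proof.
by rewrite /dback map_flatten -map_comp; congr flatten; apply: eq_map => i /=;
   rewrite map_nseq.
Qed.

Local Notation sym := (gsymmetric (S := O U) (@fst int (O U -> O U)) good).

Lemma gsymmetric_swap F X Y s : sym F -> good X -> good Y -> all good s ->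
  F [:: X, Y & s] = eps (X.1 * Y.1) * F [:: Y, X & s].
Proof. by move=> symF gX gY gs; rewrite (symF [::]) //= gX gY. Qed.

(** Linearity over functions in the first argument, expressed in the frame so that
    no closure of the fields under products with functions is involved; graded
    symmetry carries it to all arguments. *)
Definition tensorial (F : seq (vf U) -> O U) := forall X s,
  good X -> all good s -> F (X :: s) = \sum_i X.2 (x i) * F (frame c i :: s).

Lemma sym_frames F : sym F -> gsymmetric deg predT (F \o map (frame c)).
Proof.
move=> symF s1 a b s2 _ /=; rewrite !map_cat /= symF; last first.
  by rewrite all_cat /= !good_frames !good_frame.
by rewrite /= mulrNN.
Qed.

(** Expanding every field in the frame and sorting reduces F to the monomials
    d_x^I, up to sign.  If I is not admissible, a field of odd degree occurs twice
    and symmetry alone forces the value 0 in characteristic 0. *)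
Lemma tensorial_eq0 F : sym F -> tensorial F ->
  (forall I, adm deg I -> F (dback c I) = 0) ->
  forall s, all good s -> F s = 0.
Proof.
move=> symF tF F0.
have Fw l : F (map (frame c) l) = 0.
  pose I : mi n := [ffun b => count_mem b l].
  have lI : perm_eq l (spell (descending n) I).
    by apply/allP => b _ /=; rewrite count_spell1 ?ffunE // => ?; exact: count_descending.
  have [z] := gsymmetric_perm (sym_frames symF) lI; rewrite /= -dbackE => ->.
  have [aI|] := boolP (adm deg I); first by rewrite F0 // mulr0.
  case/forallPn => i; rewrite negb_imply -ltnNge => /andP[oi Ii].
  set l' := spell (descending n) I in lI *; have i1 : i \in l'.
    by rewrite -has_pred1 has_count count_spell1 //; [lia|exact: count_descending].
  have i2 : i \in rem i l'.
    rewrite -has_pred1 has_count count_rem i1 /= eqxx count_spell1 //; first lia.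
    exact: count_descending.
  have pl' : perm_eq l' (i :: i :: rem i (rem i l')).
    by apply: perm_trans (perm_to_rem i1) _; rewrite perm_cons perm_to_rem.
  have [z' /=] := gsymmetric_perm (sym_frames symF) pl'; rewrite -dbackE => ->.
  suff -> : F (frame c i :: frame c i :: map (frame c) (rem i (rem i l'))) = 0.
    by rewrite !mulr0.
  apply: (@nat_mul_inj _ _ _ _ _ _ 2) => //; rewrite mulr0 mulr_natl mulr2n.
  apply/eqP; rewrite addr_eq0; apply/eqP.
  rewrite [LHS](symF [::]) /= ?good_frame ?good_frames //.
  by rewrite epsE mulrNN odd_absM oi mulN1r.
(* Frame fields accumulate in front while those of s are expanded one by one. *)
suff Fl s l : all good s -> F (map (frame c) l ++ s) = 0 by move=> s; exact: (Fl s [::]).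
elim: s l => [|X s IH] l; first by rewrite cats0.
move=> /= /andP[gX gs].
rewrite (gsymmetric_front symF) ?all_cat /= ?good_frames ?gX //.
rewrite tF ?all_cat ?good_frames // [X in _ * X]big1 ?mulr0 // => i _.
by rewrite (IH (i :: l)) // mulr0.
Qed.

Section Covariant.
Variable D : connection M.

Definition nablavf (X Y : vf U) : vf U := (X.1 + Y.1, nabla D X.2 Y.2).

Lemma good_nablavf X Y : good X -> good Y -> good (nablavf X Y).
Proof.
by move=> /goodP gX /goodP gY; apply/goodP; exact: nabla_vfield.
Qed.

(** The value of F on nabla_X s, with each derived field moved to the front: in
    this form it is again a signed sum over the entries of s. *)
Definition nablasum (F : seq (vf U) -> O U) (X : vf U) (s : seq (vf U)) : O U :=
  picksum fst (fun Y q => F (nablavf X Y :: q)) s.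

Lemma nablaS_nablasum F X s : sym F -> good X -> all good s ->
  \sum_(t <- nablaS D X s) eps t.1 * F t.2 = nablasum F X s.
Proof.
move=> symF gX gs; rewrite big_map -{1}[size s]subn0 -/(index_iota 0 (size s)).
rewrite big_mkord /nablasum -(picksumE _ _ _ X); apply: eq_bigr => j _ /=.
rewrite set_nthE ltn_ord (gsymmetric_front symF) /=; last first.
  have := gs; rewrite -{1}(cat_take_drop j s) (drop_nth X) // all_cat /=.
  by rewrite all_cat /= => /and3P[-> gj ->]; rewrite good_nablavf.
by rewrite eps_eps /sdeg; congr (_ * _); apply: eps_parity; parity.
Qed.

(** The right-hand side of the recursion for pbw, without the factor 1/(n+1), for a
    functional F in place of pbw. *)
Definition pbw_step (F : seq (vf U) -> O U) (s : seq (vf U)) : O U :=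
  picksum fst (fun Y q => Y.2 (F q) - nablasum F Y q) s.

Lemma nablasum_sym F X : sym F -> good X -> sym (nablasum F X).
Proof.
move=> symF gX; apply: gsymmetric_picksum => Y gY.
by apply: gsymmetric_cons => //; exact: good_nablavf.
Qed.

Lemma pbw_step_sym F : sym F -> sym (pbw_step F).
Proof.
move=> symF; apply: gsymmetric_picksum => Y gY s1 a b s2 gs.
have vY := goodP _ gY.
by rewrite symF // (vf_eps vY) nablasum_sym // -mulrBr.
Qed.

Lemma nablasum_tensorial F X s : tensorial F -> good X -> all good s ->
  nablasum F X s = \sum_i X.2 (x i) * nablasum F (frame c i) s.
Proof.
move=> tF gX gs; rewrite -picksum_sum.
apply: eq_picksum gs => Y q gY gq _.
have [vX vY] := (goodP _ gX, goodP _ gY).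
rewrite tF ?good_nablavf //=.
under eq_bigr do rewrite (nabla_coordsl D _ vX vY) mulr_suml.
rewrite exchange_big /=; apply: eq_bigr => i _.
rewrite tF ?good_nablavf ?good_frame // mulr_sumr.
by apply: eq_bigr => j _; rewrite mulrA.
Qed.

(** The Leibniz terms X(Y(x_i)) F(d_i s) of X(F(Y s)) and of F(nabla_X Y s) cancel,
    which makes the difference linear over functions in Y. *)
Lemma nablasum_cons_tensorial F X Y s : sym F -> tensorial F ->
  good X -> good Y -> all good s ->
  X.2 (F (Y :: s)) - nablasum F X (Y :: s) =
  \sum_i eps (X.1 * (Y.1 + deg i)) *
    (Y.2 (x i) * (X.2 (F (frame c i :: s)) - nablasum F X (frame c i :: s))).
Proof.
move=> symF tF gX gY gs; have [vX vY] := (goodP _ gX, goodP _ gY).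
have hY i : isH (Y.1 + deg i) (Y.2 (x i)) by apply: vf_isH (isH_cx c i).
pose e i := eps (X.1 * (Y.1 + deg i)) * Y.2 (x i).
have -> : X.2 (F (Y :: s)) = \sum_i X.2 (Y.2 (x i)) * F (frame c i :: s)
                           + \sum_i e i * X.2 (F (frame c i :: s)).
  rewrite tF // (vf_sum vX) -big_split; apply: eq_bigr => i _ /=.
  by rewrite (vfM vX _ (hY i)) mulrA.
have nabXY j : (nablavf X Y).2 (x j) =
    X.2 (Y.2 (x j)) + \sum_i e i * (nablavf X (frame c i)).2 (x j).
  rewrite /= (nabla_coordsr D _ vX vY) big_split /=; congr (_ + _).
    rewrite (bigD1 j) //= cd_cx eqxx mulr1 big1 ?addr0 // => i /negbTE ij.
    by rewrite cd_cx ij mulr0.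
  by apply: eq_bigr => i _; rewrite mulrA.
have -> : nablasum F X (Y :: s) =
    \sum_i X.2 (Y.2 (x i)) * F (frame c i :: s)
    + \sum_i e i * nablasum F X (frame c i :: s).
  rewrite /nablasum picksum_cons tF ?good_nablavf //.
  under [X in _ = _ + X]eq_bigr do rewrite picksum_cons mulrDr.

  under [X in X + _ = _]eq_bigr => j _ do rewrite nabXY mulrDl mulr_suml.
  rewrite !big_split /= -addrA; congr (_ + (_ + _)).
    rewrite exchange_big; apply: eq_bigr => i _ /=.
    rewrite tF ?good_nablavf ?good_frame // mulr_sumr.
    by apply: eq_bigr => j _; rewrite mulrA.
  rewrite -picksum_sum; apply: eq_picksum gs => Z q gZ gq _.
  rewrite (gsymmetric_swap symF) ?good_nablavf //.
  rewrite tF ?good_nablavf //= ?good_nablavf // !mulr_sumr; apply: eq_bigr => i _.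
  rewrite (gsymmetric_swap symF) ?good_nablavf ?good_frame // /e.
  rewrite -[in RHS]mulrA ![Y.2 _ * (eps _ * _)]mul_eps !eps_eps.
  rewrite /= (@eps_parity _ _ (X.1 * (Y.1 + deg i) + - deg i * Z.1)) //; parity.
rewrite opprD addrACA subrr add0r -sumrB; apply: eq_bigr => i _.
by rewrite -mulrBr /e mulrA.
Qed.

Lemma pbw_step_tensorial F : sym F -> tensorial F -> tensorial (pbw_step F).
Proof.
move=> symF tF X s gX gs; rewrite /pbw_step /=.
under [RHS]eq_bigr do rewrite /= mulrDr.
rewrite big_split /=; congr (_ + _).
  rewrite (nablasum_tensorial tF gX gs) {1}(vfield_coords (goodP _ gX)) -sumrB.
  by apply: eq_bigr => i _; rewrite mulrBr.
rewrite -picksum_sum; apply: eq_picksum gs => Y q gY gq _.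
rewrite nablasum_cons_tensorial // mulr_sumr; apply: eq_bigr => i _.
rewrite [X.2 _ * (eps _ * _)]mul_eps eps_eps; congr (_ * _).
by apply: eps_parity; rewrite /=; parity.
Qed.

End Covariant.
End Functionals.

(** * The pairing with a formal series *)

Section SupportedSeries.
Variables (S : pzRingType) (N : nat) (deg : 'I_N -> int).
Implicit Types (xi : mi N -> S) (I : mi N).

(** Coefficients at exponents that repeat a variable of odd degree carry no
    information; on series where they vanish, [psder] obeys its formula without
    the case distinction. *)
Definition supported xi := forall I, ~~ adm deg I -> xi I = 0.

Lemma supported_psder a xi : supported (psder deg a xi).
Proof. by move=> I; rewrite /psder => /negbTE->. Qed.

Lemma psderE a xi I : supported xi -> psder deg a xi I =
  eps (deg a * \sum_(b < N | (b < a)%N) deg b *+ I b)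
    * ((I a).+1%:R * xi (addmi I (unitmi a))).
Proof.
move=> sxi; rewrite /psder mulr_natl; case: ifP => // aI.
rewrite sxi ?mul0rn ?mulr0 //; apply/negP => /adm_addmi.
by rewrite aI.
Qed.

Lemma sum_below_addmi a b I :
  \sum_(q < N | (q < a)%N) deg q *+ addmi I (unitmi b) q =
  \sum_(q < N | (q < a)%N) deg q *+ I q + (if (b < a)%N then deg b else 0).
Proof.
under eq_bigr do rewrite ffunE mulrnDr.
rewrite big_split /=; congr (_ + _); case: ifP => ba.
  rewrite (bigD1 b) //= ffunE eqxx big1 ?addr0 // => q /andP[_ /negbTE qb].
  by rewrite ffunE qb.
by rewrite big1 // => q qa; rewrite ffunE; case: eqP qa ba => // -> ->.
Qed.

Lemma psder_comm a b xi : supported xi ->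
  psder deg a (psder deg b xi) =
  fun I => eps (deg a * deg b) * psder deg b (psder deg a xi) I.
Proof.
move=> sxi; apply/funext => I.
rewrite !psderE //; try exact: supported_psder.
rewrite !(mul_eps _ _%:R) !eps_eps.
have -> : addmi (addmi I (unitmi a)) (unitmi b) =
          addmi (addmi I (unitmi b)) (unitmi a).
  by apply/ffunP => q; rewrite !ffunE addnAC.
have [->|ab] := eqVneq a b.
  set J := addmi (addmi I _) _; have [aJ|/sxi->] := boolP (adm deg J); last by rewrite !mulr0.
  congr (_ * _); apply: eps_parity; have /(_ b) := adm_le1 aJ.
  rewrite !ffunE eqxx; case: (boolP (odd `|deg b|%N)) => ob Ib.
    by have := Ib isT; lia.
  by rewrite !odd_absD !odd_absM (negbTE ob).
rewrite !sum_below_addmi !ffunE (negbTE ab) eq_sym (negbTE ab) !addn0.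
rewrite [X in _ * X = _]mul_nat; congr (_ * _); apply: eps_parity.
have := ltngtP a b; case: ltngtP ab => // [||/val_inj->]; last by rewrite eqxx.
- by move=> _ _ _; parity.
by move=> _ _ _; parity.
Qed.

End SupportedSeries.

Section Pairing.
Variables (R : realType) (k : ground) (m r : nat) (M : gmanifold R k m r).
Variable c : coords M.
Local Notation n := (m + r)%N.
Local Notation U := (cdom c).
Local Notation deg := (cdeg c).
Local Notation x := (cx c).
Implicit Types (xi : mi n -> O U) (X : vf U) (s : seq (vf U)).

Lemma pairingE s xi :
  pairing s xi = \sum_(I <- multis n (size s)) pairmono s I * xi I.
Proof. by rewrite sum_multisE. Qed.

Lemma pairmonoE s I : pairmono s I =
  permanent deg x fst snd (0, id) s (word I).
Proof. by []. Qed.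

Lemma pairing_nil xi : pairing (c := c) [::] xi = xi mi0.
Proof.
rewrite pairingE (big_rem mi0) /=; last first.
  by rewrite mem_multis /msize big1 // => b _; rewrite ffunE.
rewrite big_seq big1 ?addr0 => [|I].
  rewrite pairmonoE (_ : word mi0 = [::]) ?permanent_nil ?mul1r //.
  apply/nilP; rewrite /nilp wordE size_spell; last exact: count_ascending.
  by rewrite /msize big1 // => b _; rewrite ffunE.
rewrite mem_rem_uniq ?multis_uniq // !inE mem_multis => /andP[I0 sI].
case/negP: I0; apply/eqP/ffunP => b; rewrite ffunE.
by apply/eqP; rewrite -leqn0 -(eqP sI) leq_msize.
Qed.

(** Contraction with X acts on the series as sum_i X(x_i) d/dy_i: the Laplace
    expansion over the letters of y^I turns, after the shift of I by i, into the
    derivative of the series. *)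
Lemma pairing_cons X s xi : supported deg xi ->
  pairing (X :: s) xi =
  \sum_i eps (deg i * sdeg s) * (X.2 (x i) * pairing s (psder deg i xi)).
Proof.
move=> sxi; rewrite pairingE /=.
have E I : I \in multis n (size s).+1 -> pairmono (X :: s) I * xi I =
    \sum_i (if (0 < I i)%N then
       eps (deg i * sdeg s) * (X.2 (x i) * (pairmono s (submi I (unitmi i)) *
         (eps (deg i * \sum_(b < n | (b < i)%N) deg b *+ I b) *
           ((I i)%:R * xi I)))) else 0).
  rewrite mem_multis => /eqP sI.
  have [aI|/sxi->] := boolP (adm deg I); last first.
    by rewrite mulr0 big1 // => i _; rewrite !mulr0 if_same.
  rewrite pairmonoE permanent_cons; last first.
    by rewrite wordE size_spell ?sI //; exact: count_ascending.
  rewrite picksum_word // mulr_suml; apply: eq_bigr => i _.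
  case: posnP => [->|Ii]; first by rewrite mulr0n mul0r.
  rewrite -mulr_natr -pairmonoE -!mulrA; rewrite [_ * (eps _ * _)]mul_eps.
  rewrite [X.2 _ * (eps _ * _)]mul_eps.
  by rewrite [RHS]mul_eps.
rewrite big_seq (eq_bigr _ E) -big_seq exchange_big; apply: eq_bigr => i _ /=.
rewrite -big_mkcond sum_multisS pairingE !mulr_sumr; apply: eq_bigr => I _.
rewrite submiD psderE // !ffunE eqxx addn1; do 4 congr (_ * _).
rewrite sum_below_addmi ltnn addr0 //.
Qed.

Local Hint Resolve supported_psder : core.

Lemma pairing_frame i s xi : supported deg xi ->
  pairing (frame c i :: s) xi =
  eps (deg i * sdeg s) * pairing s (psder deg i xi).
Proof.
move=> sxi; rewrite pairing_cons // (bigD1 i) //= cd_cx eqxx mul1r.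
by rewrite big1 ?addr0 // => j /negbTE ji; rewrite cd_cx eq_sym ji mul0r mulr0.
Qed.

Lemma pairing_tensorial xi : supported deg xi ->
  tensorial (fun s => pairing (c := c) s xi).
Proof.
move=> sxi X s _ _; rewrite pairing_cons //; apply: eq_bigr => i _.
by rewrite pairing_frame // mul_eps.
Qed.

Lemma pairing_scale z s xi :
  pairing s (fun I => eps z * xi I) = eps z * pairing s xi.
Proof.
by rewrite !pairingE mulr_sumr; apply: eq_bigr => I _; rewrite mul_eps.
Qed.

(** By [pairing_cons] the first two fields enter through X(x_i) Y(x_j) and two
    derivatives of the series, both of which commute up to sign. *)
Lemma pairing_sym xi : supported deg xi ->
  gsymmetric (S := O U) (@fst int (O U -> O U)) (@good _ _ _ _ _ c)
    (fun s => pairing (c := c) s xi).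
Proof.
move=> sxi s1 X Y s2; elim: s1 xi sxi => [|Z s1 IH] xi sxi /=.
  case/and3P=> gX gY gs.
  rewrite !pairing_cons // mulr_sumr.
  under eq_bigr do rewrite pairing_cons // !mulr_sumr.
  under [RHS]eq_bigr do rewrite pairing_cons // !mulr_sumr.
  rewrite exchange_big; apply: eq_bigr => j _; apply: eq_bigr => i _ /=.
  have hX : isH (X.1 + deg i) (X.2 (x i)) by apply: (vf_isH (goodP _ gX)); exact: isH_cx.
  have hY : isH (Y.1 + deg j) (Y.2 (x j)) by apply: (vf_isH (goodP _ gY)); exact: isH_cx.
  rewrite (psder_comm j i sxi) pairing_scale; set P := pairing s2 _.
  rewrite !(mul_eps _ (Y.2 (x j))) eps_eps !(mul_eps _ (X.2 (x i))).
  rewrite [X.2 _ * (Y.2 _ * P)]mulrA (hom_comm (open_cdom c) hX hY) -!mulrA.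
  rewrite !eps_eps /sdeg !big_cons; congr (_ * _).
  by rewrite -!mulr_sumr; apply: eps_parity; parity.
case/andP=> gZ gs; rewrite !pairing_cons // mulr_sumr; apply: eq_bigr => i _.
rewrite IH // /sdeg !big_cat /= !big_cons [Y.1 + (X.1 + _)]addrCA.
rewrite [Z.2 _ * (eps _ * _)]mul_eps !eps_eps; congr (_ * _).
by apply: eps_parity; parity.
Qed.

(** Extracting the largest letter i, which comes first in d_x^I, produces the
    factor I_i; no sign is left, because the letters before i in y^I cancel
    against those of the remaining monomial. *)
Lemma pairing_dback I xi : supported deg xi -> adm deg I ->
  pairing (dback c I) xi = (mfact I)%:R * xi I.
Proof.
move=> + aI; rewrite dbackE.
have [p sI] : {p | msize I = p} by exists (msize I).
elim: p I aI sI xi => [|p IH] I aI sI xi sxi.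
  have I0 : I = mi0.
    by apply/ffunP => b; apply/eqP; rewrite ffunE -leqn0 -sI leq_msize.
  have -> : spell (descending n) I = [::].
    by apply/nilP; rewrite /nilp size_spell ?sI //; exact: count_descending.
  rewrite pairing_nil I0 /mfact big1 ?mul1r // => b _.
  by rewrite ffunE.
have := size_spell (@count_descending n) I; rewrite sI.
case E : (spell (descending n) I) => [//|i l] _.
have cI b : I b = count_mem b (i :: l).
  by rewrite -E count_spell1 //; exact: count_descending.
have Ii : (0 < I i)%N by rewrite cI /= eqxx.
have El : l = spell (descending n) (submi I (unitmi i)).
  rewrite -(rem_spell (@count_descending n) (@ge_ord_refl n) (@ge_ord_trans n)
           (@ge_ord_anti n) (@sorted_descending n) Ii).
  by rewrite E /= eqxx.
have Ib (b : 'I_n) : (i < b)%N -> I b = 0%N.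
  move=> ib; rewrite cI; apply/count_memPn; rewrite inE negb_or.
  apply/andP; split; first by apply: contraTneq ib => ->; rewrite ltnn.
  apply: contraL ib => bl; rewrite -leqNgt.
  have := sorted_spell I (@ge_ord_refl n) (@ge_ord_trans n) (@sorted_descending n).
  rewrite E /= path_sortedE; last exact: ge_ord_trans.
  by case/andP=> /allP /(_ _ bl).
rewrite /= pairing_frame // El IH //; last 2 first.
- exact: adm_submi.
- by apply: succn_inj; rewrite -sI (msize_submi Ii).
rewrite psderE // addmiB // !ffunE eqxx subn1 prednK // (mfact_submi Ii) natrM -mulrA.
rewrite (mul_eps _ _%:R) eps_eps eps_even ?mul1r //.
have -> : sdeg (map (frame c) (spell (descending n) (submi I (unitmi i)))) =
    - \sum_b deg b *+ submi I (unitmi i) b.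
  rewrite -(sum_spell (@count_descending n) xpredT) /sdeg big_map -sumrN.
  by [].
rewrite (bigID (fun b : 'I_n => (b < i)%N)) /=.
set z := \sum_(b < _ | ~~ _) _.
(* No letter above i occurs in I, and i occurs only once if its degree is odd. *)
suff : ~~ (odd `|deg i|%N && odd `|z|%N) by parity.
apply/negP => /andP[oi]; apply/negP; rewrite /z big1 // => b.
rewrite -leqNgt leq_eqVlt => /orP[/eqP/val_inj <-|ib]; last first.
  by rewrite ffunE Ib // mulr0n.
by rewrite !ffunE eqxx; have := adm_le1 aI oi; case: (I i) => [|[]].
Qed.

End Pairing.

(** * Contraction of the flatness equation *)

Section Submultis.
Variable N : nat.
Implicit Types I J K : mi N.

Definition submultis I : seq (mi N) :=
  [seq [ffun b => I' b : nat] | I' : {ffun 'I_N -> 'I_(msize I).+1}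
     in [pred I' : {ffun 'I_N -> 'I_(msize I).+1} | [forall b, (I' b <= I b)%N]]].

Lemma mem_submultis I J : (J \in submultis I) = [forall b, (J b <= I b)%N].
Proof.
apply/mapP/forallP => [[I'] + ->|JI].
  by rewrite mem_enum inE => /forallP I'I b; rewrite ffunE.
exists [ffun b => inord (J b)].
  rewrite mem_enum inE; apply/forallP => b.
  by rewrite ffunE inordK ?JI // ltnS (leq_trans (JI b)) // leq_msize.
apply/ffunP => b.
by rewrite !ffunE inordK // ltnS (leq_trans (JI b)) // leq_msize.
Qed.

Lemma submultis_uniq I : uniq (submultis I).
Proof.
rewrite map_inj_uniq ?enum_uniq // => J K /ffunP JK.
by apply/ffunP => b; apply: val_inj; have := JK b; rewrite !ffunE.
Qed.

Lemma submiK I J : [forall b, (J b <= I b)%N] -> submi I (submi I J) = J.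
Proof. by move=> /forallP JI; apply/ffunP => b; rewrite !ffunE subKn. Qed.

Lemma submi_le I J : [forall b, (submi I J b <= I b)%N].
Proof. by apply/forallP => b; rewrite ffunE leq_subr. Qed.

(** The summation runs over the right factor, which below is free of the dx. *)
Lemma psmulE (S : pzRingType) (deg : 'I_N -> int) e (f g : mi N -> S) J :
  adm deg J -> psmul deg e f g J =
  \sum_(J2 <- submultis J)
     eps ((e - wt deg (submi J J2)) * wt deg J2 + msign deg (submi J J2) J2)
       * f (submi J J2) * g J2.
Proof.
move=> aJ; rewrite /psmul aJ.
transitivity (\sum_(J1 <- submultis J)
     eps ((e - wt deg J1) * wt deg (submi J J1) + msign deg J1 (submi J J1))
       * f J1 * g (submi J J1)).
  by rewrite /submultis big_image; apply: eq_bigl => J'; rewrite inE.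
have pe : perm_eq (submultis J) (map (submi J) (submultis J)).
  apply: uniq_perm; rewrite ?submultis_uniq //.
    rewrite map_inj_in_uniq ?submultis_uniq // => K L.
    by rewrite !mem_submultis => /submiK {2}<- /submiK {2}<- ->.
  move=> K; rewrite mem_submultis; apply/idP/mapP => [KJ|[L _ ->]].
    by exists (submi J K); rewrite ?submiK // mem_submultis submi_le.
  exact: submi_le.
rewrite (perm_big _ pe) big_map big_seq [RHS]big_seq; apply: eq_bigr => K.
by rewrite mem_submultis => KJ; rewrite submiK.
Qed.

Lemma wt_addmi (deg : 'I_N -> int) I J : wt deg (addmi I J) = wt deg I + wt deg J.
Proof.
by rewrite /wt -big_split; apply: eq_bigr => b _; rewrite ffunE mulrnDr.
Qed.

Lemma wt_unitmi (deg : 'I_N -> int) a : wt deg (unitmi a) = deg a.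
Proof.
rewrite /wt (bigD1 a) //= ffunE eqxx big1 ?addr0 // => b /negbTE ba.
by rewrite ffunE ba.
Qed.

Lemma msign_addmi (deg : 'I_N -> int) I J a :
  msign deg (addmi I (unitmi a)) J =
  msign deg I J + deg a * \sum_(b < N | (b < a)%N) deg b *+ J b.
Proof.
rewrite /msign [in LHS](bigD1 a) //= [X in _ = X + _](bigD1 a) //= -addrA.
rewrite [X in _ = _ + X]addrC addrA mulr_sumr -big_split; congr (_ + _).
  apply: eq_bigr => b _; rewrite !ffunE eqxx mulnDl mul1n mulrnDr.
  by rewrite mulrnAr.
by apply: eq_bigr => b /negbTE ba; rewrite !ffunE ba addn0.
Qed.

End Submultis.

Section DoubleIndices.
Variables (R : realType) (k : ground) (m r : nat) (M : gmanifold R k m r).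
Variable c : coords M.
Local Notation n := (m + r)%N.
Local Notation U := (cdom c).
Local Notation deg := (cdeg c).
Local Notation vd := (vdeg c).
Implicit Types (K I : mi n) (J : mi (n + n)) (i : 'I_n).

Lemma joinmi_dx K I i : joinmi K I (dxv i) = K i.
Proof. by rewrite ffunE (unsplitK (inl i)). Qed.

Lemma joinmi_y K I i : joinmi K I (yv i) = I i.
Proof. by rewrite ffunE (unsplitK (inr i)). Qed.

Lemma vdeg_dx i : vd (dxv i) = 1 + deg i.
Proof. by rewrite /vdeg (unsplitK (inl i)). Qed.

Lemma vdeg_y i : vd (yv i) = deg i.
Proof. by rewrite /vdeg (unsplitK (inr i)). Qed.

Lemma eq_double (T : Type) (F G : 'I_(n + n) -> T) :
  (forall i, F (dxv i) = G (dxv i)) -> (forall i, F (yv i) = G (yv i)) ->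
  F =1 G.
Proof. by move=> Fd Fy a; rewrite -(splitK a); case: fintype.split. Qed.

Lemma dxpart_join K I : dxpart (joinmi K I) = K.
Proof. by apply/ffunP => i; rewrite ffunE joinmi_dx. Qed.

Lemma ypart_join K I : ypart (joinmi K I) = I.
Proof. by apply/ffunP => i; rewrite ffunE joinmi_y. Qed.

Lemma join_parts J : joinmi (dxpart J) (ypart J) = J.
Proof.
by apply/ffunP; apply: eq_double => i; rewrite ?joinmi_dx ?joinmi_y ffunE.
Qed.

Lemma adm_join K I : (forall i, (K i <= 1)%N) ->
  adm vd (joinmi K I) = adm deg I.
Proof.
move=> K1; apply/forallP/forallP => [H i|H a].
  by have := H (yv i); rewrite vdeg_y joinmi_y.
move: a; apply: (@eq_double _ _ (fun=> true)) => i.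
  by rewrite joinmi_dx K1 implybT.
by rewrite vdeg_y joinmi_y H.
Qed.

Lemma sum_double (V : nmodType) (P : pred 'I_(n + n)) (F : 'I_(n + n) -> V) :
  \sum_(a | P a) F a =
  \sum_(i | P (dxv i)) F (dxv i) + \sum_(i | P (yv i)) F (yv i).
Proof.
by rewrite big_mkcond big_split_ord /= -!big_mkcond.
Qed.

Lemma before_dx i K I :
  \sum_(b < n + n | (b < dxv i)%N) vd b *+ joinmi K I b =
  \sum_(b < n | (b < i)%N) (1 + deg b) *+ K b.
Proof.
rewrite sum_double [X in _ + X]big_pred0 ?addr0 => [|b]; last first.
  by rewrite /= ltnNge (leq_trans (ltnW (ltn_ord i))) ?leq_addr.
by apply: eq_bigr => b _; rewrite vdeg_dx joinmi_dx.
Qed.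

Lemma before_y i K I :
  \sum_(b < n + n | (b < yv i)%N) vd b *+ joinmi K I b =
  \sum_(b < n) (1 + deg b) *+ K b + \sum_(b < n | (b < i)%N) deg b *+ I b.
Proof.
rewrite sum_double; congr (_ + _).
  apply: eq_big => [b|b _]; last by rewrite vdeg_dx joinmi_dx.
  by rewrite /= (leq_trans (ltn_ord b)) ?leq_addr.
by apply: eq_big => [b|b _]; [rewrite /= ltn_add2l|rewrite vdeg_y joinmi_y].
Qed.

Lemma unitmi_dx i : unitmi (dxv i) = joinmi (unitmi i) (mi0 : mi n).
Proof.
apply/ffunP; apply: eq_double => j; rewrite ?joinmi_dx ?joinmi_y !ffunE.
  by rewrite (inj_eq (@lshift_inj _ _)).
by rewrite eq_rlshift.
Qed.

Lemma unitmi_y i : unitmi (yv i) = joinmi (mi0 : mi n) (unitmi i).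
Proof.
apply/ffunP; apply: eq_double => j; rewrite ?joinmi_dx ?joinmi_y !ffunE.
  by rewrite eq_lrshift.
by rewrite (inj_eq (@rshift_inj _ _)).
Qed.

Lemma addmi_join K K' I I' :
  addmi (joinmi K I) (joinmi K' I') = joinmi (addmi K K') (addmi I I').
Proof.
apply/ffunP; apply: eq_double => j.
  by rewrite joinmi_dx [LHS]ffunE [RHS]ffunE !joinmi_dx.
by rewrite joinmi_y [LHS]ffunE [RHS]ffunE !joinmi_y.
Qed.

Lemma submi_join K K' I I' :
  submi (joinmi K I) (joinmi K' I') = joinmi (submi K K') (submi I I').
Proof.
apply/ffunP; apply: eq_double => j.
  by rewrite joinmi_dx [LHS]ffunE [RHS]ffunE !joinmi_dx.
by rewrite joinmi_y [LHS]ffunE [RHS]ffunE !joinmi_y.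
Qed.

Lemma add0mi K : addmi mi0 K = K.
Proof. by apply/ffunP => b; rewrite !ffunE. Qed.

Lemma addmi0 K : addmi K mi0 = K.
Proof. by apply/ffunP => b; rewrite !ffunE addn0. Qed.

Lemma submi0 K : submi K mi0 = K.
Proof. by apply/ffunP => b; rewrite !ffunE subn0. Qed.

Lemma submi_self K : submi K K = mi0.
Proof. by apply/ffunP => b; rewrite !ffunE subnn. Qed.

Lemma msize_join K I : msize (joinmi K I) = (msize K + msize I)%N.
Proof.
rewrite /msize big_split_ord /=; congr (_ + _)%N; apply: eq_bigr => i _.
  exact: joinmi_dx.
exact: joinmi_y.
Qed.

Lemma msize_mi0 N : msize (mi0 : mi N) = 0%N.
Proof. by rewrite /msize big1 // => b _; rewrite ffunE. Qed.

Lemma wt_join K I : wt vd (joinmi K I) = \sum_b (1 + deg b) *+ K b + wt deg I.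
Proof.
rewrite /wt sum_double; congr (_ + _); apply: eq_bigr => i _.
  by rewrite vdeg_dx joinmi_dx.
by rewrite vdeg_y joinmi_y.
Qed.

Lemma sum_mi0 (V : zmodType) (P : pred 'I_n) (F : 'I_n -> V) :
  \sum_(b | P b) F b *+ (mi0 : mi n) b = 0.
Proof. by rewrite big1 // => b _; rewrite ffunE. Qed.

Lemma sum_unitmi (V : zmodType) (F : 'I_n -> V) i :
  \sum_b F b *+ (unitmi i : mi n) b = F i.
Proof.
rewrite (bigD1 i) //= ffunE eqxx big1 ?addr0 // => b /negbTE bi.
by rewrite ffunE bi.
Qed.

Lemma unitmi_le1 i j : ((unitmi i : mi n) j <= 1)%N.
Proof. by rewrite ffunE; case: eqP. Qed.

Lemma mi0_le1 j : ((mi0 : mi n) j <= 1)%N.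
Proof. by rewrite ffunE. Qed.

(** The coefficient at y^I of sum_i y_i i_(d/dx_i) v for a 1-form v, that is
    delta^-1 v without its factor 1/|I|, see [contraction_deltainv]. *)
Definition contraction (v : lform c) I : O U :=
  \sum_i (if (0 < I i)%N then
    eps (deg i * \sum_(b < n | (b < i)%N) deg b *+ I b)
      * v (joinmi (unitmi i) (submi I (unitmi i))) else 0).

Lemma wedge_dx (G : 'I_n -> lform c) i I : adm deg I ->
  \sum_j psvar vd (dxv j) (G j) (joinmi (unitmi i) I) = G i (joinmi mi0 I).
Proof.
move=> aI; rewrite (bigD1 i) //= [X in _ + X]big1 ?addr0 => [|j /negbTE ji].
  rewrite /psvar adm_join ?aI ?joinmi_dx; last exact: unitmi_le1.
  rewrite ffunE eqxx /= before_dx big1 ?mulr0 ?eps0 ?mul1r => [|b].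
    by rewrite unitmi_dx submi_join submi_self submi0.
  by rewrite ffunE; case: eqP => // ->; rewrite ltnn.
by rewrite /psvar joinmi_dx ffunE ji andbF.
Qed.

Lemma contraction_delta (w : lform c) I : adm deg I ->
  contraction (delta w) I = (msize I)%:R * w (joinmi mi0 I).
Proof.
move=> aI; rewrite /msize natr_sum mulr_suml; apply: eq_bigr => i _.
case: posnP => [->|Ii]; first by rewrite mul0r.
have aI' : adm deg (submi I (unitmi i)) by exact: adm_submi.
rewrite /delta wedge_dx // /psder adm_join ?aI'; last exact: mi0_le1.
rewrite vdeg_y before_y sum_mi0 add0r unitmi_y addmi_join addmi0 addmiB // joinmi_y.
rewrite !ffunE eqxx subn1 prednK // eps_eps.
rewrite -{1}(addmiB Ii) sum_below_addmi ltnn addr0 eps_even ?mul1r ?mulr_natl //.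
by parity.
Qed.

Lemma contraction_covd D (w : lform c) I : adm deg I ->
  contraction (covd D w) I = \sum_i (if (0 < I i)%N then
    eps (deg i * \sum_(b < n | (b < i)%N) deg b *+ I b)
      * dualnabla D i (fun I' => w (joinmi mi0 I')) (submi I (unitmi i)) else 0).
Proof.
move=> aI; apply: eq_bigr => i _; case: ifP => // Ii; congr (_ * _).
rewrite /covd wedge_dx; last exact: adm_submi.
rewrite /formnabla dxpart_join ypart_join wt_join !sum_mi0.
by rewrite /wt sum_mi0 add0r mulr0 eps0 mul1r.
Qed.

Lemma contraction_deltainv (v : lform c) I : adm deg I ->
  deltainv v (joinmi mi0 I) = 0 -> contraction v I = 0.
Proof.
move=> aI; rewrite /deltainv msize_join msize_mi0 add0n => H.
have [I0|I0] := posnP (msize I).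
  rewrite /contraction big1 // => i _; rewrite ifN // -leqNgt -I0; exact: leq_msize.
rewrite -[LHS](kst_natK _ I0) mul_nat.
suff -> : contraction v I = \sum_(i < n) psder vd (dxv i) (psvar vd (yv i) v) (joinmi mi0 I).
  by rewrite H mulr0.
apply: eq_bigr => i _.
rewrite /psder adm_join ?aI; last exact: mi0_le1.
rewrite before_dx sum_mi0 mulr0 eps0 mul1r joinmi_dx ffunE mulr1n.
rewrite unitmi_dx addmi_join add0mi addmi0.
rewrite /psvar adm_join ?aI ?joinmi_y; last exact: unitmi_le1.
case: ifP => //= _; rewrite unitmi_y submi_join submi0 before_y sum_unitmi vdeg_y.
by congr (_ * _); apply: eps_parity; parity.
Qed.

Lemma msign_join K I I' :
  msign vd (joinmi K I) (joinmi (mi0 : mi n) I') = msign deg I I'.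
Proof.
rewrite /msign sum_double [X in X + _]big1 ?add0r => [|i _].
  apply: eq_bigr => i _; rewrite sum_double [X in X + _]big1 ?add0r => [|b _].
    apply: eq_big => [b|b _]; first by rewrite /= ltn_add2l.
    by rewrite !vdeg_y !joinmi_y.
  by rewrite !joinmi_dx [mi0 _]ffunE muln0 mulr0n.
rewrite sum_double [X in X + _]big1 ?add0r => [|b _].
  rewrite big_pred0 // => b.
  by rewrite /= ltnNge (leq_trans (ltnW (ltn_ord i))) ?leq_addr.
by rewrite !joinmi_dx [mi0 _]ffunE muln0 mulr0n.
Qed.

Lemma submiAC K I I' : submi (submi K I) I' = submi (submi K I') I.
Proof. by apply/ffunP => b; rewrite !ffunE subnAC. Qed.

(** As g is free of the dx, the factor dx_i belongs to f.  The sign is written in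
    terms of I - I2, the exponent of f after the contraction, so that apart from
    the last summand it does not depend on i. *)
Lemma psmul_contracted e (f g : lform c) I i : adm deg I -> (0 < I i)%N ->
  (forall J, dxpart J != mi0 -> g J = 0) ->
  psmul vd e f g (joinmi (unitmi i) (submi I (unitmi i))) =
  \sum_(I2 <- submultis I | (I2 i < I i)%N)
    eps ((e - (1 + wt deg (submi I I2))) * wt deg I2 + msign deg (submi I I2) I2
         - deg i * \sum_(b < n | (b < i)%N) deg b *+ I2 b)
    * f (joinmi (unitmi i) (submi (submi I I2) (unitmi i))) * g (joinmi mi0 I2).
Proof.
move=> aI Ii g0; set J := joinmi _ _.
have aJ : adm vd J by rewrite adm_join ?adm_submi //; exact: unitmi_le1.
rewrite psmulE // (bigID (fun J2 => dxpart J2 == mi0)) /= [X in _ + X]big1 ?addr0; last first.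
  by move=> J2 /g0->; rewrite mulr0.
have pe : perm_eq [seq J2 <- submultis J | dxpart J2 == mi0]
                  (map (joinmi mi0) [seq I2 : mi n <- submultis I | (I2 i < I i)%N]).
  apply: uniq_perm; rewrite ?filter_uniq ?submultis_uniq //.
    rewrite map_inj_uniq ?filter_uniq ?submultis_uniq // => K L KL.
    by rewrite -(ypart_join mi0 K) KL ypart_join.
  move=> J2; rewrite mem_filter mem_submultis; apply/andP/mapP.
    case=> /eqP J20 /forallP J2J; exists (ypart J2); last by rewrite -J20 join_parts.
    rewrite mem_filter mem_submultis; have H b := J2J (yv b).
    apply/andP; split; first by have := H i; rewrite joinmi_y !ffunE eqxx; lia.
    by apply/forallP => b; have := H b; rewrite joinmi_y !ffunE; lia.
  case=> I2; rewrite mem_filter mem_submultis => /andP[I2i /forallP I2I] ->.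
  split; first by rewrite dxpart_join.
  apply/forallP; apply: (@eq_double _ _ (fun=> true)) => b.
    by rewrite joinmi_dx ffunE.
  rewrite !joinmi_y !ffunE; have := I2I b.
  by case: eqP => [->|_] /=; lia.
rewrite -big_filter (perm_big _ pe) big_map big_filter; apply: eq_bigr => I2 I2i.
rewrite /J submi_join submi0 submiAC msign_join !wt_join sum_mi0 add0r sum_unitmi.
have Ki : (0 < submi I I2 i)%N by rewrite ffunE subn_gt0.
set K := submi I I2 in Ki *.
have -> : wt deg K = wt deg (submi K (unitmi i)) + deg i.
  by rewrite -{1}(addmiB Ki) wt_addmi wt_unitmi.
have -> : msign deg K I2 = msign deg (submi K (unitmi i)) I2
    + deg i * \sum_(b < n | (b < i)%N) deg b *+ I2 b.
  by rewrite -{1}(addmiB Ki) msign_addmi.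
congr (eps _ * _ * _).
by rewrite addrA addrK -[1 + deg i + _]addrA [deg i + _]addrC.
Qed.

(** contraction (f g) = (contraction f) g, up to sign, for g free of the dx. *)
Lemma contraction_psmul e (f g : lform c) I : adm deg I ->
  (forall I', adm deg I' -> contraction f I' = 0) ->
  (forall J, dxpart J != mi0 -> g J = 0) ->
  contraction (psmul vd e f g) I = 0.
Proof.
move=> aI f0 g0.
transitivity (\sum_(I2 <- submultis I)
    eps ((e - (1 + wt deg (submi I I2))) * wt deg I2 + msign deg (submi I I2) I2)
    * contraction f (submi I I2) * g (joinmi mi0 I2)); last first.
  by rewrite big1 // => I2 _; rewrite f0 ?mulr0 ?mul0r // adm_submi.
rewrite /contraction.
under [RHS]eq_bigr do rewrite mulr_sumr mulr_suml.
rewrite exchange_big; apply: eq_bigr => i _ /=.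
rewrite [RHS](bigID (fun I2 : mi n => (I2 i < I i)%N)) /=.
rewrite [X in _ + X]big1 ?addr0; last first.
  by move=> I2 I2i; rewrite ffunE subn_gt0 (negbTE I2i) mulr0 mul0r.
case: posnP => [Ii|Ii].
  by rewrite big_pred0 // => I2; rewrite Ii.
rewrite psmul_contracted // mulr_sumr [LHS]big_seq_cond [RHS]big_seq_cond.
apply: eq_bigr => I2 /andP[]; rewrite mem_submultis => /forallP I2I I2i.
rewrite [submi _ _ i]ffunE subn_gt0 I2i !mulrA -!epsD; congr (eps _ * _ * _).
have -> : \sum_(b < n | (b < i)%N) deg b *+ I b =
    \sum_(b < n | (b < i)%N) deg b *+ submi I I2 b
    + \sum_(b < n | (b < i)%N) deg b *+ I2 b.
  by rewrite -big_split; apply: eq_bigr => b _ /=; rewrite ffunE -mulrnDr subnK.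
by rewrite mulrDr [RHS]addrC -addrA; congr (_ + _); rewrite addrC subrK.
Qed.

Lemma contraction_act (A : 'I_n -> lform c) (w : lform c) I : adm deg I ->
  (forall j J, deltainv (A j) J = 0) ->
  (forall J, dxpart J != mi0 -> w J = 0) ->
  contraction (act A w) I = 0.
Proof.
move=> aI A0 w0.
transitivity (\sum_j contraction (psmul vd (1 + deg j) (A j) (psder vd (yv j) w)) I).
  rewrite /contraction exchange_big; apply: eq_bigr => i _ /=.
  by case: ifP => _; [rewrite /act mulr_sumr|rewrite big1].
rewrite big1 // => j _; apply: contraction_psmul => // [I' aI'|J J0].
  exact: contraction_deltainv.
rewrite /psder w0 ?mul0rn ?mulr0 ?if_same //.
by rewrite -(join_parts J) unitmi_y addmi_join dxpart_join addmi0.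
Qed.

Lemma Dop_recursion D (A : 'I_n -> lform c) (w : lform c) I : adm deg I ->
  (forall j J, deltainv (A j) J = 0) ->
  (forall J, dxpart J != mi0 -> w J = 0) ->
  (forall J, Dop D A w J = 0) ->
  (msize I)%:R * w (joinmi mi0 I) = \sum_i (if (0 < I i)%N then
    eps (deg i * \sum_(b < n | (b < i)%N) deg b *+ I b)
      * dualnabla D i (fun I' => w (joinmi mi0 I')) (submi I (unitmi i)) else 0).
Proof.
move=> aI A0 w0 Dw; rewrite -contraction_delta // -contraction_covd //.
have : contraction (Dop D A w) I = 0.
  by rewrite /contraction big1 // => i _; rewrite Dw mulr0 if_same.
have -> : contraction (Dop D A w) I = - contraction (delta w) I
    + contraction (covd D w) I + contraction (act A w) I.
  rewrite /contraction -sumrN -!big_split; apply: eq_bigr => i _ /=.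
  by case: ifP => _; rewrite ?oppr0 ?addr0 // /Dop !mulrDr mulrN.
rewrite contraction_act // addr0 addrC => /eqP; rewrite subr_eq0 => /eqP->.
by [].
Qed.

End DoubleIndices.

(** * The formal exponential map *)

Section FormalExponential.
Variables (R : realType) (k : ground) (m r : nat) (M : gmanifold R k m r).
Variables (D : connection M) (c : coords M).
Local Notation n := (m + r)%N.
Local Notation U := (cdom c).
Local Notation deg := (cdeg c).

Variable xi : mi n -> O U.
Hypothesis xi_supp : supported deg xi.
Hypothesis xi_rec : forall I, adm deg I ->
  (msize I)%:R * xi I = \sum_i (if (0 < I i)%N then
    eps (deg i * \sum_(b < n | (b < i)%N) deg b *+ I b)
      * dualnabla D i xi (submi I (unitmi i)) else 0).

Local Notation Phi := (fun s : seq (vf U) => pairing s xi).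
Let Phi_sym := pairing_sym xi_supp.
Let Phi_tensorial := pairing_tensorial xi_supp.

(** The defining duality of nabla on series, with the sum over the derived factors
    of d_x^I in its signed-sum form. *)
Lemma dualnablaE i I : adm deg I ->
  dualnabla D i xi I = kst U ((mfact I)%:R^-1) *
    (eps (deg i * wt deg I) *
       (cd (c := c) i (Phi (dback c I)) - nablasum D Phi (frame c i) (dback c I))).
Proof.
move=> aI; rewrite /dualnabla aI -mulrA; congr (_ * (_ * (_ - _))).
  rewrite dbackE /sdeg big_map sumrN (sum_spell (@count_descending n) xpredT).
  by apply: eps_parity; parity.
apply: (nablaS_nablasum D (F := Phi)) => //; first exact: good_frame.
by rewrite dbackE; exact: good_frames.
Qed.

Lemma size_dback I : size (dback c I) = msize I.
Proof. by rewrite dbackE size_map size_spell //; exact: count_descending. Qed.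

(** Extracting one of the I_i copies of d_i leaves d_x^(I - e_i); the factors I_i
    turn 1/(I - e_i)! of the dual connection into 1/I!. *)
Lemma pbw_step_dback I : adm deg I ->
  (msize I)%:R * Phi (dback c I) = pbw_step D Phi (dback c I).
Proof.
move=> aI /=; rewrite pairing_dback // mul_nat xi_rec // mulr_sumr.
rewrite /pbw_step [in RHS]dbackE (picksum_map (d := deg)); last first.
  by move=> i j /=; rewrite mulrNN.
rewrite picksum_descending //; apply: eq_bigr => i _.
case: posnP => [->|Ii]; first by rewrite mulr0.
rewrite -!dbackE; set I' := submi I (unitmi i).
rewrite dualnablaE ?adm_submi // (mfact_submi Ii) -/I' natrM -mulrA.
rewrite -(mul_eps _ (kst _ _)) -(mul_nat _ (kst _ _)) -(mul_nat _ (kst _ _)).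
rewrite kst_natK ?mfact_gt0 // -[RHS]mulr_natl; congr (_ * _).
rewrite eps_eps; congr (_ * _); apply: eps_parity.
have -> : \sum_(b < n | (b < i)%N) deg b *+ I b =
          \sum_(b < n | (b < i)%N) deg b *+ I' b.
  by rewrite -{1}(addmiB Ii) sum_below_addmi ltnn addr0.
have -> : wt deg I' = \sum_(b < n | (b < i)%N) deg b *+ I' b
    + (deg i *+ I' i + \sum_(b < n | (i < b)%N) deg b *+ I b).
  rewrite /wt (bigID (fun b : 'I_n => (b < i)%N)) /=; congr (_ + _).
  rewrite (bigD1 i) ?ltnn //=; congr (_ + _).
  apply: eq_big => [b|b]; first by rewrite -leqNgt andbC eq_sym [RHS]ltn_neqAle.
  by case/andP=> _ /negbTE bi; rewrite !ffunE bi subn0.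
(* The letters before i cancel, the letter i contributes evenly by admissibility. *)
rewrite !(odd_absD, odd_absM, odd_absMn) !ffunE eqxx /=.
have := adm_le1 aI (a := i); case: (odd `|deg i|%N) => //= /(_ isT).
by case: (I i) Ii => [|[]] //= _ _; parity.
Qed.

Lemma pbw_step_pairing s : all (@good _ _ _ _ _ c) s ->
  (size s)%:R * pairing s xi = pbw_step D Phi s.
Proof.
move=> gs; apply/eqP; rewrite -subr_eq0; apply/eqP; move: s gs.
apply: (@tensorial_eq0 _ _ _ _ _ _
  (fun s => (size s)%:R * pairing s xi - pbw_step D Phi s)).
- move=> s1 X Y s2 gs; rewrite (Phi_sym gs) (pbw_step_sym D Phi_sym gs).
  by rewrite mul_eps -mulrBr !size_cat.
- move=> X s gX gs; rewrite (Phi_tensorial gX gs).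
  rewrite (pbw_step_tensorial D Phi_sym Phi_tensorial gX gs) mulr_sumr -sumrB.
  by apply: eq_bigr => i _; rewrite mulrBr mul_nat.
by move=> I aI; rewrite -pbw_step_dback // size_dback subrr.
Qed.

(** nabla_X preserves the number of factors: the induction hypothesis applies to
    every term. *)
Lemma eq_nablaS (F G : seq (vf U) -> O U) X s :
  good X -> all (@good _ _ _ _ _ c) s ->
  (forall s', all (@good _ _ _ _ _ c) s' -> size s' = size s -> F s' = G s') ->
  \sum_(t <- nablaS D X s) eps t.1 * F t.2 =
  \sum_(t <- nablaS D X s) eps t.1 * G t.2.
Proof.
move=> gX gs FG; rewrite !big_map big_seq [RHS]big_seq; apply: eq_bigr => j.
rewrite mem_iota add0n => /= js; congr (_ * _); apply: FG.
  have := gs; rewrite set_nthE js -{1}(cat_take_drop j s) (drop_nth X) // !all_cat /=.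
  by case/and3P=> -> gj ->; rewrite [good _]good_nablavf.
by rewrite size_set_nth; apply/maxn_idPr.
Qed.

Lemma pbw_pairing s : all (@good _ _ _ _ _ c) s ->
  pbw D s (xi mi0) = pairing s xi.
Proof.
rewrite /pbw; have [p sp] : {p | size s = p} by exists (size s).
rewrite sp; elim: p s sp => [|p IH] s sp gs.
  by case: s sp gs => //= _ _; rewrite pairing_nil.
case: s sp gs => [//|X [|Y s] sp gs].
  rewrite -[RHS]mul1r (pbw_step_pairing gs).
  by rewrite /pbw_step /= subr0 addr0 pairing_nil; case: (p).
have -> : pbw_rec D p.+1 [:: X, Y & s] (xi mi0) =
    let l := [:: X, Y & s] in kst U ((size l)%:R^-1) *
    \sum_(j < size l) eps ((nth X l j).1 * sdeg (take j l)) *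
      ((nth X l j).2 (pbw_rec D p (take j l ++ drop j.+1 l) (xi mi0))
       - \sum_(t <- nablaS D (nth X l j) (take j l ++ drop j.+1 l))
           eps t.1 * pbw_rec D p t.2 (xi mi0)) by [].
move: gs sp; set l := [:: X, Y & s] => gs sp /=.
rewrite -[RHS](@kst_natK _ _ _ _ _ _ (size l)) ?sp // -sp pbw_step_pairing //.
congr (_ * _); rewrite /pbw_step -(picksumE _ _ _ X); apply: eq_bigr => j _ /=.
set l' := take j l ++ drop j.+1 l; congr (_ * _).
have [gj gl'] : good (nth X l j) /\ all (@good _ _ _ _ _ c) l'.
  have := gs; rewrite -{1}(cat_take_drop j l) (drop_nth X) // /l' !all_cat /=.
  by case/and3P=> -> -> ->.
have sl' : size l' = p.
  have := sp; rewrite -{1}(cat_take_drop j l) (drop_nth X) // /l' !size_cat /=.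
  by rewrite addnS => -[].
rewrite IH // -(nablaS_nablasum D Phi_sym gj gl'); congr (_ - _).
apply: (eq_nablaS (F := fun q => pbw_rec D p q (xi mi0)) (G := Phi) gj gl').
move=> s' gs' ss'.
by apply: IH; rewrite // ss'.
Qed.

End FormalExponential.

Section FlatSections.
Variables (R : realType) (k : ground) (m r : nat) (M : gmanifold R k m r).
Variables (c : coords M).
Local Notation n := (m + r)%N.

Lemma pform0_supp (w : lform c) J : is_pform 0 w ->
  ~~ (adm (vdeg c) J && (dxpart J == mi0)) -> w J = 0.
Proof.
case=> s [W [hW ->]] nJ; rewrite big1 // => q _.
apply/eqP; apply: contraNT nJ => WJ; have [_ /(_ WJ)[-> sJ]] := hW q J.
apply/eqP/ffunP => b; rewrite [RHS]ffunE; apply/eqP.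
by rewrite -leqn0 -sJ leq_msize.
Qed.

End FlatSections.

Theorem corollary5p7 (R : realType) (k : ground) (m r : nat)
    (M : gmanifold R k m r) (D : connection M)
    (A : forall c : coords M, 'I_(m + r) -> lform c)
    (tau : O (M := M) setT -> forall c : coords M, lform c) :
  torsionfree D -> is_Anabla D A -> is_tau D A tau ->
  forall (c : coords M) (f : O (M := M) setT),
    tau f c =
    yseries (fun I : mi (m + r) =>
      kst (cdom c) ((mfact I)%:R^-1) *
      pbw D (dback c I) (restr (cdom c) f)).
Proof.
move=> _ [_ [_ [_ [dA _]]]] tauP c f.
have [[_ /(_ c) w0] /(_ c) sw /(_ c) Dw] := tauP f.
set w := tau f c in w0 sw Dw *.
pose xi I := w (joinmi mi0 I).
have xi_supp : supported (cdeg c) xi.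
  move=> I aI; apply: (pform0_supp w0).
  by rewrite adm_join ?(negbTE aI) // => i; rewrite ffunE.
have wdx J : dxpart J != mi0 -> w J = 0.
  by move=> J0; apply: (pform0_supp w0); rewrite (negbTE J0) andbF.
have xi_rec I : adm (cdeg c) I -> (msize I)%:R * xi I = _ :=
  fun aI => Dop_recursion aI (dA c) wdx Dw.
apply/funext => J; rewrite /yseries; case: ifP => [/andP[aJ /eqP J0]|/negbT]; last first.
  exact: pform0_supp.
have eJ : J = joinmi mi0 (ypart J) by rewrite -J0 join_parts.
have aI : adm (cdeg c) (ypart J).
  by rewrite -(@adm_join _ _ _ _ _ _ mi0) -?eJ // => i; rewrite ffunE.
rewrite -sw /sigma -/w (_ : w mi0 = xi mi0); last first.
  by congr w; apply/ffunP; apply: eq_double => i; rewrite ?joinmi_dx ?joinmi_y !ffunE.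
rewrite (pbw_pairing xi_supp xi_rec); last by rewrite dbackE good_frames.
by rewrite pairing_dback // kst_natK ?mfact_gt0 // {1}eJ.
Qed.
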